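(* Let $f:\mathbb R\to\mathbb R$ be a smooth, odd, $2\pi$-periodic function, and let $\delta=(E,f)$ be the perturbation data on $(S^2\times I,\{a,b,c,d\}\times I)$, $I=[0,1]$, described in the context. Then the map $$P\to R_\delta(S^2\times I,\{a,b,c,d\}\times I)$$ induced by the inclusion $S^2\times\{0\}\to S^2\times I$ is a homeomorphism, and the composite $$P\to R_\delta(S^2\times I,\{a,b,c,d\}\times I)\to R(S^2\times\{0,1\},\{a,b,c,d\}\times\{0,1\})=P\times P$$ is the graph of the self homeomorphism (smooth away from the corners) of the pillowcase $$c_\delta:P\to P,\qquad c_\delta(\gamma,\theta)=(\gamma,\theta+2f(\gamma+\pi)).$$ Using the 1-parameter family of perturbations $tf$, $t\in[0,1]$, gives an isotopy from the identity $Id:P\to P$ to $c_\delta:P\to P$.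
   Context: $SU(2)$ is the group of unit quaternions; ''traceless'' means purely imaginary. $R(A,B)$ is the space of conjugacy classes of representations $\pi_1(A\setminus B)\to SU(2)$ sending meridians of $B$ to traceless elements. Pillowcase: $P=\mathbb R^2/G$, $G$ generated by $(\gamma,\theta)\mapsto(\gamma+2\pi,\theta)$, $(\gamma,\theta)\mapsto(\gamma,\theta+2\pi)$, $(\gamma,\theta)\mapsto(-\gamma,-\theta)$; corners are the images of $(\pi\mathbb Z)^2$. With $\pi_1(S^2\setminus\{a,b,c,d\})=\langle a,b,c,d\mid ba=cd\rangle$, $P\cong R(S^2,\{a,b,c,d\})$ via $(\gamma,\theta)\mapsto(a\mapsto\mathbf i,\ b\mapsto e^{\gamma\mathbf k}\mathbf i,\ c\mapsto e^{\theta\mathbf k}\mathbf i,\ d\mapsto e^{(\theta-\gamma)\mathbf k}\mathbf i)$. Perturbation: let $e\subset S^2\setminus\{a,b,c,d\}$ be a simple closed curve separating $\{a,b\}$ from $\{c,d\}$, representing the class $ba=cd$, and let $E:S^1\times D^2\to (S^2\setminus\{a,b,c,d\})\times I$ be a tubular neighborhood of the curve obtained by pushing $e$ into the interior of $S^2\times I$. The group $\pi_1(S^2\times I\setminus(\{a,b,c,d\}\times I\cup E))$ is generated by the meridians $a,b,c,d$ of the punctures in $S^2\times\{0\}$ and the meridian $\mu_E$ of $E$; the longitude of $E$ is $\lambda_E=ba$; and the corresponding meridians of the punctures in $S^2\times\{1\}$ are $a'=a$, $b'=b$, $c'=\mu_Ec\mu_E^{-1}$, $d'=\mu_Ed\mu_E^{-1}$.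 $R_\delta(S^2\times I,\{a,b,c,d\}\times I)$ is the space of conjugacy classes of representations $\rho$ of this group in $SU(2)$ sending $a,b,c,d$ to traceless elements and satisfying: $\rho(\lambda_E)=e^{\alpha Q}$ implies $\rho(\mu_E)=e^{f(\alpha)Q}$ ($Q$ a purely imaginary unit quaternion). The second map restricts representations to the two boundary components. *)

(* Defs.v *)
From HB Require Import structures.
From mathcomp Require Import all_boot all_order all_algebra.
From mathcomp Require Import ring.
From mathcomp Require Import all_classical all_reals all_analysis.

Set Implicit Arguments.
Unset Strict Implicit.
Unset Printing Implicit Defensive.

Import Order.TTheory GRing.Theory Num.Theory.
Import numFieldNormedType.Exports.

Local Open Scope classical_set_scope.
Local Open Scope quotient_scope.
Local Open Scope ring_scope.

Section Quotients.
Context {T : choiceType} (E : T -> T -> Prop).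
Hypotheses (Er : forall x, E x x) (Es : forall x y, E x y -> E y x)
  (Et : forall x y z, E x y -> E y z -> E x z).

Definition brel : rel T := fun x y => `[< E x y >].

Let brel_refl : reflexive brel.
Proof. by move=> x; apply/asboolP. Qed.

Let brel_sym : symmetric brel.
Proof. by move=> x y; apply/asboolP/asboolP; exact: Es. Qed.

Let brel_trans : transitive brel.
Proof.
by move=> y x z /asboolP xy /asboolP yz; apply/asboolP; exact: Et xy yz.
Qed.

Definition equiv_rel_of : equiv_rel T := EquivRel brel brel_refl brel_sym brel_trans.

Lemma equiv_rel_ofP (x y : T) :
  \pi_{eq_quot equiv_rel_of} x = \pi_{eq_quot equiv_rel_of} y <-> E x y.
Proof. by split=> [/eqmodP/asboolP|xy]; last apply/eqmodP/asboolP. Qed.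

Lemma equiv_rel_of_repr (x : T) : E (repr (\pi_{eq_quot equiv_rel_of} x)) x.
Proof. by apply/equiv_rel_ofP; rewrite reprK. Qed.
End Quotients.

Definition homeomorphism (X Y : topologicalType) (h : X -> Y) : Prop :=
  continuous h /\
  exists g : Y -> X, [/\ cancel h g, cancel g h & continuous g].

Definition isotopy (R : realType) (X : topologicalType)
    (h : R -> X -> X) (h0 h1 : X -> X) : Prop :=
  [/\ {within `[0 : R, 1]%classic `*` [set: X],
        continuous (fun p : R * X => h p.1 p.2)},
      forall t, 0 <= t <= 1 -> homeomorphism (h t),
      h 0 = h0 & h 1 = h1].

(* [(x, true)] is the letter x and [(x, false)] its formal inverse. *)
Definition word (X : Type) := seq (X * bool).

Definition posw {X : Type} (s : seq X) : word X := [seq (x, true) | x <- s].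

Section Presentation.
Context {X : choiceType}.

Inductive word_eq (rels : seq (word X * word X)) : word X -> word X -> Prop :=
| word_eq_refl u : word_eq rels u u
| word_eq_sym u v : word_eq rels u v -> word_eq rels v u
| word_eq_trans u v w : word_eq rels u v -> word_eq rels v w -> word_eq rels u w
| word_eq_cancel u v x b : word_eq rels (u ++ (x, b) :: (x, ~~ b) :: v) (u ++ v)
| word_eq_rel u v r : r \in rels -> word_eq rels (u ++ r.1 ++ v) (u ++ r.2 ++ v).

Context (rels : seq (word X * word X)).

Definition word_equiv : equiv_rel (word X) :=
  equiv_rel_of (word_eq_refl rels) (@word_eq_sym rels) (@word_eq_trans rels).

Definition presented : Type := {eq_quot word_equiv}.
HB.instance Definition _ := EqQuotient.on presented.
HB.instance Definition _ := Choice.on presented.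

Definition pword (w : word X) : presented := \pi_presented w.

Lemma pwordP u v : pword u = pword v <-> word_eq rels u v.
Proof. exact: equiv_rel_ofP. Qed.

Lemma pword_repr (g : presented) : pword (repr g) = g.
Proof. exact: reprK. Qed.

Definition winv (w : word X) : word X := rev [seq (l.1, ~~ l.2) | l <- w].

Definition pone : presented := pword [::].
Definition pmul (g h : presented) : presented := pword (repr g ++ repr h).
Definition pinv (g : presented) : presented := pword (winv (repr g)).

Lemma word_eq_catl u v w : word_eq rels u v -> word_eq rels (w ++ u) (w ++ v).
Proof.
elim=> {u v} [u|u v _|u v t _ uv _|u v x b|u v r rin].
- exact: word_eq_refl.
- exact: word_eq_sym.
- exact: word_eq_trans uv.
- by rewrite !catA; exact: word_eq_cancel.
- by rewrite !(catA w); exact: word_eq_rel.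
Qed.

Lemma word_eq_catr u v w : word_eq rels u v -> word_eq rels (u ++ w) (v ++ w).
Proof.
elim=> {u v} [u|u v _|u v t _ uv _|u v x b|u v r rin].
- exact: word_eq_refl.
- exact: word_eq_sym.
- exact: word_eq_trans uv.
- by rewrite -!catA; exact: word_eq_cancel.
- by rewrite -!catA; exact: word_eq_rel.
Qed.

Lemma word_eq_winvl w : word_eq rels (winv w ++ w) [::].
Proof.
elim: w => [|[x b] w IH]; first exact: word_eq_refl.
rewrite /winv /= rev_cons cat_rcons.
apply: word_eq_trans IH.
by rewrite -{2}[b]negbK; exact: word_eq_cancel.
Qed.

Lemma winvK : involutive winv.
Proof.
move=> w; rewrite /winv map_rev revK -map_comp -[RHS]map_id.
by apply: eq_map => -[x b] /=; rewrite negbK.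
Qed.

Lemma word_eq_winvr w : word_eq rels (w ++ winv w) [::].
Proof. by rewrite -{1}[w]winvK; exact: word_eq_winvl. Qed.

Lemma pword_cat u v : pword (u ++ v) = pmul (pword u) (pword v).
Proof.
apply/pwordP/word_eq_sym.
apply: (@word_eq_trans _ _ (repr (pword u) ++ v)).
  by apply: word_eq_catl; exact: equiv_rel_of_repr.
by apply: word_eq_catr; exact: equiv_rel_of_repr.
Qed.

Lemma pmulA : associative pmul.
Proof.
move=> g h k; rewrite -[g]pword_repr -[h]pword_repr -[k]pword_repr.
by rewrite -!pword_cat catA.
Qed.

Lemma pmul1g : left_id pone pmul.
Proof. by move=> g; rewrite -[g]pword_repr -pword_cat. Qed.

Lemma pmulg1 : right_id pone pmul.
Proof. by move=> g; rewrite -[g]pword_repr -pword_cat cats0. Qed.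

Lemma pmulVg : left_inverse pone pinv pmul.
Proof.
move=> g; rewrite -[X in pmul _ X]pword_repr -pword_cat.
by apply/pwordP; exact: word_eq_winvl.
Qed.

Lemma pmulgV : right_inverse pone pinv pmul.
Proof.
move=> g; rewrite -[X in pmul X _]pword_repr -pword_cat.
by apply/pwordP; exact: word_eq_winvr.
Qed.

HB.instance Definition _ := isGroup.Build presented
  pmulA pmul1g pmulg1 pmulVg pmulgV.

Lemma pwordM u v : (pword u * pword v)%g = pword (u ++ v).
Proof. by rewrite [RHS]pword_cat. Qed.

Definition pgen (x : X) : presented := pword (posw [:: x]).

Context {H : groupType} (phi : X -> H).

Definition weval (w : word X) : H :=
  foldr (fun l h => (if l.2 then phi l.1 else (phi l.1)^-1) * h)%g 1%g w.

(* Meaningful when phi respects the relations, see [pliftM] and [plift_gen]. *)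
Definition plift (g : presented) : H := weval (repr g).

Lemma weval_cat u v : weval (u ++ v) = (weval u * weval v)%g.
Proof. by elim: u => [|l u IH] /=; rewrite ?mul1g// IH mulgA. Qed.

Hypothesis phi_rels : forall r, r \in rels -> weval r.1 = weval r.2.

Lemma plift_pword w : plift (pword w) = weval w.
Proof.
have: word_eq rels (repr (pword w)) w by exact: equiv_rel_of_repr.
rewrite /plift; move: (repr _) => u.
elim=> {u w} [//|u v _ ->//|u v w _ -> _ ->//|u v x b|u v r rin].
  by rewrite !weval_cat; congr (_ * _)%g; case: b; rewrite /= mulgA ?mulgV ?mulVg mul1g.
by rewrite !weval_cat phi_rels.
Qed.

Lemma pliftM (g h : presented) : plift (g * h)%g = (plift g * plift h)%g.
Proof. by rewrite plift_pword weval_cat. Qed.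

Lemma plift_gen x : plift (pgen x) = phi x.
Proof. by rewrite plift_pword /= mulg1. Qed.
End Presentation.

(* (x0, x1, x2, x3) is the quaternion x0 + x1 i + x2 j + x3 k. *)
Definition quat (R : realType) : Type := (R * R * R * R)%type.

Section Quaternions.
Context {R : realType}.

Definition qre (p : quat R) : R := p.1.1.1.

Definition qmul (p q : quat R) : quat R :=
  let: (p0, p1, p2, p3) := p in
  let: (q0, q1, q2, q3) := q in
  (p0 * q0 - p1 * q1 - p2 * q2 - p3 * q3,
   p0 * q1 + p1 * q0 + p2 * q3 - p3 * q2,
   p0 * q2 - p1 * q3 + p2 * q0 + p3 * q1,
   p0 * q3 + p1 * q2 - p2 * q1 + p3 * q0).

Definition qconj (p : quat R) : quat R :=
  let: (p0, p1, p2, p3) := p in (p0, - p1, - p2, - p3).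

Definition qnorm2 (p : quat R) : R :=
  let: (p0, p1, p2, p3) := p in p0 ^+ 2 + p1 ^+ 2 + p2 ^+ 2 + p3 ^+ 2.

Lemma qmulA : associative qmul.
Proof.
move=> [[[a0 a1] a2] a3] [[[b0 b1] b2] b3] [[[c0 c1] c2] c3] /=.
by congr (_, _, _, _); ring.
Qed.

Lemma qnorm2M p q : qnorm2 (qmul p q) = qnorm2 p * qnorm2 q.
Proof. by move: p q => [[[a0 a1] a2] a3] [[[b0 b1] b2] b3] /=; ring. Qed.

Lemma qnorm2_conj p : qnorm2 (qconj p) = qnorm2 p.
Proof. by move: p => [[[a0 a1] a2] a3] /=; ring. Qed.

Lemma qmulVq p : qmul (qconj p) p = (qnorm2 p, 0, 0, 0).
Proof. by move: p => [[[a0 a1] a2] a3] /=; congr (_, _, _, _); ring. Qed.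

Lemma qmulqV p : qmul p (qconj p) = (qnorm2 p, 0, 0, 0).
Proof. by move: p => [[[a0 a1] a2] a3] /=; congr (_, _, _, _); ring. Qed.

Lemma qmul1q p : qmul (1, 0, 0, 0) p = p.
Proof. by move: p => [[[a0 a1] a2] a3] /=; congr (_, _, _, _); ring. Qed.

Lemma qmulq1 p : qmul p (1, 0, 0, 0) = p.
Proof. by move: p => [[[a0 a1] a2] a3] /=; congr (_, _, _, _); ring. Qed.

Lemma qre_mulC p q : qre (qmul p q) = qre (qmul q p).
Proof. by move: p q => [[[a0 a1] a2] a3] [[[b0 b1] b2] b3] /=; rewrite /qre/=; ring. Qed.
End Quaternions.

(* The unit quaternions, with the topology induced from R^4. *)
Definition SU2 (R : realType) : Type := set_type [set q : quat R | qnorm2 q = 1].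
HB.instance Definition _ (R : realType) := Topological.on (SU2 R).

Section SU2Group.
Context {R : realType}.

Definition mkSU2 (q : quat R) (q1 : qnorm2 q = 1) : SU2 R :=
  exist _ q (mem_set q1).

Definition uquat (u : SU2 R) : quat R := \val u.

Lemma uquat_inj : injective uquat.
Proof. exact: val_inj. Qed.

Lemma uquat1 (u : SU2 R) : qnorm2 (uquat u) = 1.
Proof. by have := svalP u; rewrite inE. Qed.

Fact one_subproof : qnorm2 ((1, 0, 0, 0) : quat R) = 1.
Proof. by rewrite /=; ring. Qed.

Fact mul_subproof (u v : SU2 R) : qnorm2 (qmul (uquat u) (uquat v)) = 1.
Proof. by rewrite qnorm2M !uquat1 mulr1. Qed.

Fact inv_subproof (u : SU2 R) : qnorm2 (qconj (uquat u)) = 1.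
Proof. by rewrite qnorm2_conj uquat1. Qed.

Definition su2_one : SU2 R := mkSU2 one_subproof.
Definition su2_mul (u v : SU2 R) : SU2 R := mkSU2 (mul_subproof u v).
Definition su2_inv (u : SU2 R) : SU2 R := mkSU2 (inv_subproof u).

Lemma su2_mulA : associative su2_mul.
Proof. by move=> u v w; apply: uquat_inj; exact: qmulA. Qed.

Lemma su2_mul1g : left_id su2_one su2_mul.
Proof. by move=> u; apply: uquat_inj; exact: qmul1q. Qed.

Lemma su2_mulg1 : right_id su2_one su2_mul.
Proof. by move=> u; apply: uquat_inj; exact: qmulq1. Qed.

Lemma su2_mulVg : left_inverse su2_one su2_inv su2_mul.
Proof. by move=> u; apply: uquat_inj; rewrite [LHS]qmulVq uquat1. Qed.

Lemma su2_mulgV : right_inverse su2_one su2_inv su2_mul.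
Proof. by move=> u; apply: uquat_inj; rewrite [LHS]qmulqV uquat1. Qed.

HB.instance Definition _ := isGroup.Build (SU2 R)
  su2_mulA su2_mul1g su2_mulg1 su2_mulVg su2_mulgV.

(* For unit quaternions, purely imaginary. *)
Definition traceless (u : SU2 R) : Prop := qre (uquat u) = 0.

Lemma tracelessJ (u g : SU2 R) : traceless u -> traceless (g * u * g^-1)%g.
Proof.
have -> : traceless (g * u * g^-1)%g = (qre (uquat (g^-1 * (g * u))%g) = 0).
  by rewrite /traceless [uquat _]/(qmul _ _) qre_mulC.
by rewrite mulKg.
Qed.

Fact qi_subproof : qnorm2 ((0, 1, 0, 0) : quat R) = 1.
Proof. by rewrite /=; ring. Qed.

Definition qi : SU2 R := mkSU2 qi_subproof.

Fact qk_subproof : qnorm2 ((0, 0, 0, 1) : quat R) = 1.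
Proof. by rewrite /=; ring. Qed.

Definition qk : SU2 R := mkSU2 qk_subproof.

(* e^{alpha Q} = cos alpha + (sin alpha) Q: the quaternion exponential when Q is
   a purely imaginary unit quaternion; not meant for any other Q. *)
Definition expq (alpha : R) (Q : SU2 R) : quat R :=
  let: (q0, q1, q2, q3) := uquat Q in
  (cos alpha, sin alpha * q1, sin alpha * q2, sin alpha * q3).

Lemma expq_unit (alpha : R) (Q : SU2 R) :
  traceless Q -> qnorm2 (expq alpha Q) = 1.
Proof.
move=> Q0; have := uquat1 Q; move: Q0; rewrite /traceless /expq.
case: (uquat Q) => [[[q0 q1] q2] q3]; rewrite /qre/= => -> Q1.
rewrite -(cos2Dsin2 alpha) -[sin alpha ^+ 2 in RHS]mulr1 -Q1; ring.
Qed.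

Fact qk_traceless : traceless qk. Proof. by []. Qed.

Definition expk (alpha : R) : SU2 R := mkSU2 (expq_unit alpha qk_traceless).

Lemma uquatM (u v : SU2 R) : uquat (u * v)%g = qmul (uquat u) (uquat v).
Proof. by []. Qed.

Lemma uquatV (u : SU2 R) : uquat u^-1%g = qconj (uquat u).
Proof. by []. Qed.

Lemma uquat_qi : uquat qi = (0, 1, 0, 0).
Proof. by []. Qed.

Lemma uquat_expk alpha : uquat (expk alpha) = (cos alpha, 0, 0, sin alpha).
Proof. by rewrite [LHS]/(expq _ _) /expq /= mulr0 mulr1. Qed.

Definition uquatE := (uquatM, uquatV, uquat_qi, uquat_expk).
End SU2Group.

(* Conjugacy classes of elements of a set A of functions into SU(2). Functions
   carry the topology of pointwise convergence, which on homomorphisms from a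
   finitely generated group is that of convergence on generators. *)
Section ConjugacyClasses.
Context {R : realType} {G : Type} (A : set {ptws G -> SU2 R}).

Definition conj_rel (r s : A) : Prop :=
  exists u : SU2 R, forall x, \val s x = (u * \val r x * u^-1)%g.

Lemma conj_rel_refl r : conj_rel r r.
Proof. by exists 1%g => x; rewrite mul1g invg1 mulg1. Qed.

Lemma conj_rel_sym r s : conj_rel r s -> conj_rel s r.
Proof.
by move=> [u rs]; exists u^-1%g => x; rewrite rs invgK !mulgA mulVg mul1g mulgVK.
Qed.

Lemma conj_rel_trans r s t : conj_rel r s -> conj_rel s t -> conj_rel r t.
Proof.
by move=> [u rs] [v st]; exists (v * u)%g => x; rewrite st rs invgM !mulgA.
Qed.

Definition conj_equiv : equiv_rel A :=
  equiv_rel_of conj_rel_refl conj_rel_sym conj_rel_trans.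

Definition conj_classes : Type := quotient_topology {eq_quot conj_equiv}.
HB.instance Definition _ := Topological.on conj_classes.

Definition conj_class (r : A) : conj_classes := \pi_{eq_quot conj_equiv} r.

Lemma conj_classP (r s : A) : conj_class r = conj_class s <-> conj_rel r s.
Proof. exact: equiv_rel_ofP. Qed.
End ConjugacyClasses.

Inductive puncture := pa | pb | pc | pd.
HB.instance Definition _ := gen_eqMixin puncture.
HB.instance Definition _ := gen_choiceMixin puncture.

(* pi_1(S^2 \ {a,b,c,d}) = < a, b, c, d | ba = cd > *)
Definition sphere_rels : seq (word puncture * word puncture) :=
  [:: (posw [:: pb; pa], posw [:: pc; pd])].
Definition sphere_group : Type := presented sphere_rels.
HB.instance Definition _ := Group.on sphere_group.

Inductive cobordism_gen := mer of puncture | muE_gen.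
HB.instance Definition _ := gen_eqMixin cobordism_gen.
HB.instance Definition _ := gen_choiceMixin cobordism_gen.

(* pi_1(S^2 x I \ ({a,b,c,d} x I \cup E))
     = < a, b, c, d, mu_E | ba = cd, mu_E commutes with ba >.
   By van Kampen along e x I: e x I minus its core pushed-in curve contributes
   the torus group of E, generated by mu_E and lambda_E = ba. *)
Definition cobordism_rels : seq (word cobordism_gen * word cobordism_gen) :=
  [:: (posw [:: mer pb; mer pa], posw [:: mer pc; mer pd]);
      (posw [:: muE_gen; mer pb; mer pa], posw [:: mer pb; mer pa; muE_gen])].
Definition cobordism_group : Type := presented cobordism_rels.
HB.instance Definition _ := Group.on cobordism_group.

Definition smer (x : puncture) : sphere_group := pgen _ x.
Definition cmer (x : puncture) : cobordism_group := pgen _ (mer x).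
Definition muE : cobordism_group := pgen _ muE_gen.
Definition lambdaE : cobordism_group := (cmer pb * cmer pa)%g.

(* The inclusions of S^2 x {0} and S^2 x {1}, on fundamental groups. *)
Definition end0_mer (x : puncture) : cobordism_group := cmer x.
Definition end1_mer (x : puncture) : cobordism_group :=
  match x with
  | pa | pb => cmer x
  | pc | pd => (muE * cmer x * muE^-1)%g
  end.
Definition incl0 : sphere_group -> cobordism_group := plift end0_mer.
Definition incl1 : sphere_group -> cobordism_group := plift end1_mer.

Lemma cobordism_ba_cd : (cmer pb * cmer pa = cmer pc * cmer pd)%g.
Proof.
rewrite /cmer /pgen !pwordM; apply/pwordP.
exact: (@word_eq_rel _ cobordism_rels [::] [::] _ (mem_head _ _)).
Qed.

Lemma cobordism_muE_lambdaE : (muE * lambdaE = lambdaE * muE)%g.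
Proof.
have -> : lambdaE = pword _ (posw [:: mer pb; mer pa]) by exact: pwordM.
rewrite /muE /pgen !pwordM; apply/pwordP.
have rin : (posw [:: muE_gen; mer pb; mer pa], posw [:: mer pb; mer pa; muE_gen])
    \in cobordism_rels by rewrite !inE eqxx orbT.
exact: (@word_eq_rel _ cobordism_rels [::] [::] _ rin).
Qed.

Lemma end0_rels r : r \in sphere_rels ->
  weval end0_mer r.1 = weval end0_mer r.2.
Proof. by rewrite inE => /eqP -> /=; rewrite !mulg1 cobordism_ba_cd. Qed.

Lemma end1_rels r : r \in sphere_rels ->
  weval end1_mer r.1 = weval end1_mer r.2.
Proof.
rewrite inE => /eqP -> /=; rewrite !mulg1 !mulgA mulgVK -(mulgA muE).
by rewrite -cobordism_ba_cd -/lambdaE cobordism_muE_lambdaE mulgK.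
Qed.

Section RepresentationSpaces.
Context {R : realType}.

Definition sphere_reps : set {ptws sphere_group -> SU2 R} :=
  [set rho | (forall g h, rho (g * h)%g = (rho g * rho h)%g) /\
             (forall x, traceless (rho (smer x)))].

Definition cobordism_reps (f : R -> R) : set {ptws cobordism_group -> SU2 R} :=
  [set rho | [/\ forall g h, rho (g * h)%g = (rho g * rho h)%g,
                 forall x, traceless (rho (cmer x)) &
                 forall (alpha : R) (Q : SU2 R), traceless Q ->
                   uquat (rho lambdaE) = expq alpha Q ->
                   uquat (rho muE) = expq (f alpha) Q]].

Definition sphere_R : Type := conj_classes sphere_reps.
HB.instance Definition _ := Topological.on sphere_R.

Definition cobordism_R (f : R -> R) : Type := conj_classes (cobordism_reps f).
HB.instance Definition _ f := Topological.on (cobordism_R f).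

Fact restrict0_subproof f (rho : cobordism_reps f) :
  sphere_reps (\val rho \o incl0).
Proof.
have := svalP rho; rewrite inE => -[rhoM rho0 _]; split=> [g h|x] /=.
  by rewrite /incl0 (pliftM end0_rels) rhoM.
by rewrite /incl0 (plift_gen end0_rels).
Qed.

Fact restrict1_subproof f (rho : cobordism_reps f) :
  sphere_reps (\val rho \o incl1).
Proof.
have := svalP rho; rewrite inE => -[rhoM rho0 _].
have rho1 : \val rho 1%g = 1%g.
  by apply: (mulIg (\val rho 1%g)); rewrite -rhoM !mul1g.
have rhoV g : \val rho g^-1%g = (\val rho g)^-1%g.
  by apply: (mulIg (\val rho g)); rewrite -rhoM !mulVg.
split=> [g h|x] /=; first by rewrite /incl1 (pliftM end1_rels) rhoM.
rewrite /incl1 (plift_gen end1_rels).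
by case: x => //=; rewrite !rhoM rhoV; exact: tracelessJ.
Qed.

Definition restrict0_rep f (rho : cobordism_reps f) : sphere_reps :=
  exist _ (\val rho \o incl0) (mem_set (restrict0_subproof rho)).
Definition restrict1_rep f (rho : cobordism_reps f) : sphere_reps :=
  exist _ (\val rho \o incl1) (mem_set (restrict1_subproof rho)).

(* Defined on a chosen representative; independent of it by [restrict_end0E] and
   [restrict_end1E]. *)
Definition restrict_end0 f (c : cobordism_R f) : sphere_R :=
  conj_class (restrict0_rep (repr c)).
Definition restrict_end1 f (c : cobordism_R f) : sphere_R :=
  conj_class (restrict1_rep (repr c)).

Lemma restrict_end0E f (rho : cobordism_reps f) :
  restrict_end0 (conj_class rho) = conj_class (restrict0_rep rho).
Proof.
apply/conj_classP.
have [u urho] : conj_rel (repr (conj_class rho)) rho.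
  exact: equiv_rel_of_repr.
by exists u => x; exact: urho.
Qed.

Lemma restrict_end1E f (rho : cobordism_reps f) :
  restrict_end1 (conj_class rho) = conj_class (restrict1_rep rho).
Proof.
apply/conj_classP.
have [u urho] : conj_rel (repr (conj_class rho)) rho.
  exact: equiv_rel_of_repr.
by exists u => x; exact: urho.
Qed.

(* R(S^2 x {0,1}, {a,b,c,d} x {0,1}): the space is disconnected, so the two
   components are conjugated independently. *)
Definition restrict_ends f (c : cobordism_R f) : sphere_R * sphere_R :=
  (restrict_end0 c, restrict_end1 c).
End RepresentationSpaces.

Section Pillowcase.
Context {R : realType}.

(* The orbit relation of G, generated by the action of its generators. *)
Inductive orbit_rel : R * R -> R * R -> Prop :=
| orbit_refl p : orbit_rel p p
| orbit_sym p q : orbit_rel p q -> orbit_rel q p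
| orbit_trans p q r : orbit_rel p q -> orbit_rel q r -> orbit_rel p r
| orbit_gamma gamma theta : orbit_rel (gamma, theta) (gamma + 2 * pi, theta)
| orbit_theta gamma theta : orbit_rel (gamma, theta) (gamma, theta + 2 * pi)
| orbit_opp gamma theta : orbit_rel (gamma, theta) (- gamma, - theta).

Definition orbit_equiv : equiv_rel (R * R)%type :=
  equiv_rel_of orbit_refl orbit_sym orbit_trans.

Definition pillowcase : Type := quotient_topology {eq_quot orbit_equiv}.
HB.instance Definition _ := Topological.on pillowcase.

Definition pil (p : R * R) : pillowcase := \pi_{eq_quot orbit_equiv} p.

Lemma pilP (p q : R * R) : pil p = pil q <-> orbit_rel p q.
Proof. exact: equiv_rel_ofP. Qed.

Definition corners : set pillowcase :=
  [set pil p | p in [set p : R * R |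
    exists m n : int, p = (m%:~R * pi, n%:~R * pi)]].

Definition pil_img (p : R * R) (x : puncture) : SU2 R :=
  match x with
  | pa => qi
  | pb => (expk p.1 * qi)%g
  | pc => (expk p.2 * qi)%g
  | pd => (expk (p.2 - p.1) * qi)%g
  end.

Lemma pil_img_rels p r : r \in sphere_rels ->
  weval (pil_img p) r.1 = weval (pil_img p) r.2.
Proof.
rewrite inE => /eqP -> /=; rewrite !mulg1; apply: uquat_inj.
rewrite !uquatE /=.
set d := p.2 - p.1; have -> : p.1 = p.2 - d by rewrite /d; ring.
by clearbody d; rewrite cosB sinB; congr (_, _, _, _); ring.
Qed.

Fact pil_rep_subproof p : sphere_reps (plift (pil_img p)).
Proof.
split=> [g h|x]; first exact: (pliftM (@pil_img_rels p)).
rewrite /smer (plift_gen (@pil_img_rels p)).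
by case: x; rewrite /traceless !uquatE /qre /=; rewrite ?(mul0r, mulr0, subr0).
Qed.

Definition pil_rep (p : R * R) : sphere_reps :=
  exist _ (plift (pil_img p)) (mem_set (pil_rep_subproof p)).

(* The identification of P with R(S^2, {a,b,c,d}); see [pil_to_RE] for
   independence of the representative. *)
Definition pil_to_R (x : pillowcase) : sphere_R := conj_class (pil_rep (repr x)).

Lemma weval_conj (phi psi : puncture -> SU2 R) (u : SU2 R) :
  (forall x, psi x = (u * phi x * u^-1)%g) ->
  forall w, weval psi w = (u * weval phi w * u^-1)%g.
Proof.
move=> uphi; elim=> [|[x b] w IH] /=; first by rewrite mulg1 mulgV.
rewrite IH uphi; case: b => /=; rewrite ?invgM ?invgK !mulgA mulgVK//.
Qed.

Lemma pil_to_RE p : pil_to_R (pil p) = conj_class (pil_rep p).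
Proof.
have eqc q q' u : (forall x, pil_img q' x = (u * pil_img q x * u^-1)%g) ->
    conj_class (pil_rep q) = conj_class (pil_rep q').
  by move=> quq; apply/conj_classP; exists u => x; exact: weval_conj.
have : orbit_rel (repr (pil p)) p by exact: equiv_rel_of_repr.
rewrite /pil_to_R; move: (repr _) => q.
elim=> {p q} [//|p q _ ->//|p q r _ -> _ ->//|g t|g t|g t].
- apply: (eqc _ _ 1%g) => x; rewrite mul1g invg1 mulg1; apply: uquat_inj.
  have gE : t - (g + 2 * pi) = t - g - 2 * pi by ring.
  have p2 : 2 * pi = pi *+ 2 :> R by rewrite mulr_natl.
  case: x; rewrite //= !uquatE.
    by rewrite p2 cosD2pi sinD2pi.
  by rewrite gE p2 -[t - g in RHS](subrK (pi *+ 2)) cosD2pi sinD2pi.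
- apply: (eqc _ _ 1%g) => x; rewrite mul1g invg1 mulg1; apply: uquat_inj.
  have tE : t + 2 * pi - g = t - g + 2 * pi by ring.
  have p2 : 2 * pi = pi *+ 2 :> R by rewrite mulr_natl.
  by case: x; rewrite //= !uquatE ?tE p2 cosD2pi sinD2pi.
- apply: (eqc _ _ qi) => x; apply: uquat_inj.
  have tE : - t - - g = - (t - g) by ring.
  by case: x; rewrite //= !uquatE ?tE ?cosN ?sinN /=; congr (_, _, _, _); ring.
Qed.

(* Defined on a chosen representative; independent of it when f is odd and
   2 pi - periodic, see [cdeltaE]. *)
Definition cdelta (f : R -> R) (x : pillowcase) : pillowcase :=
  let p := repr x in pil (p.1, p.2 + 2 * f (p.1 + pi)).

Lemma cdeltaE (f : R -> R) (gamma theta : R) :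
  (forall x, f (- x) = - f x) -> (forall x, f (x + 2 * pi) = f x) ->
  cdelta f (pil (gamma, theta)) = pil (gamma, theta + 2 * f (gamma + pi)).
Proof.
move=> fN fP; pose c p : R * R := (p.1, p.2 + 2 * f (p.1 + pi)).
suff cE q p : orbit_rel q p -> pil (c q) = pil (c p).
  by apply: (cE _ (gamma, theta)); exact: equiv_rel_of_repr.
elim=> {p q} [//|p q _ ->//|p q r _ -> _ ->//|g t|g t|g t]; apply/pilP; rewrite /c /=.
- have -> : g + 2 * pi + pi = g + pi + 2 * pi by ring.
  by rewrite fP; exact: orbit_gamma.
- have -> : t + 2 * pi + 2 * f (g + pi) = t + 2 * f (g + pi) + 2 * pi by ring.
  exact: orbit_theta.
- have -> : f (- g + pi) = - f (g + pi).
    by rewrite -fN -(fP (- (g + pi))); congr f; ring.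
  have -> : - t + 2 * - f (g + pi) = - (t + 2 * f (g + pi)) by ring.
  exact: orbit_opp.
Qed.

End Pillowcase.
Arguments pillowcase R : clear implicits.
Arguments sphere_R R : clear implicits.
Arguments corners R : clear implicits.

Section Smoothness.
Context {R : realType}.

Definition smooth_fun (f : R -> R) : Prop :=
  forall (n : nat) (x : R), derivable (derive1n n f) x 1.

Fixpoint Ck (k : nat) (U : set (R * R)) (g : R * R -> R) : Prop :=
  match k with
  | 0%N => forall p, U p -> {for p, continuous g}
  | k'.+1 =>
    [/\ forall p, U p -> derivable g p (1, 0) /\ derivable g p (0, 1),
        Ck k' U ('D_(1, 0) g) & Ck k' U ('D_(0, 1) g)]
  end.

Definition smooth_on (U : set (R * R)) (h : R * R -> R * R) : Prop :=
  forall k, Ck k U (fun p => (h p).1) /\ Ck k U (fun p => (h p).2).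

(* G acts freely on R^2 \ (pi Z)^2, so [pil] restricts to a covering of
   P \ corners, whose local inverses are the charts of its smooth structure. *)
Definition smooth_off_corners (c : pillowcase R -> pillowcase R) : Prop :=
  forall p : R * R, ~ corners R (pil p) ->
    ~ corners R (c (pil p)) /\
    exists (U : set (R * R)) (h : R * R -> R * R),
      [/\ open U, U p, smooth_on U h & forall q, U q -> c (pil q) = pil (h q)].
End Smoothness.

(* Main.v *)
(** The functions cos gamma, cos theta and cos (theta - gamma) separate the points
    of the pillowcase P, and up to sign they are the traces of ba, ca and da. As P
    is compact, the bijection from P to R(S^2, {a,b,c,d}) is a homeomorphism; it is
    onto because a, b, c, d are coplanar. A representation of the cobordism group
    is determined by its restriction to S^2 x {0}, since the perturbation condition
    forces the value at mu_E; as lambda_E = ba goes to e^{(gamma + pi) k}, mu_E goes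
    to e^{f(gamma + pi) k}, which rotates c and d by the angle 2 f(gamma + pi). *)
Require Import Defs.
From mathcomp Require Import all_boot all_order all_algebra.
From mathcomp Require Import ring lra.
From mathcomp Require Import all_classical all_reals all_analysis.
Import Order.TTheory GRing.Theory Num.Theory.
Import numFieldNormedType.Exports.

Set Implicit Arguments.
Unset Strict Implicit.
Unset Printing Implicit Defensive.

Local Open Scope classical_set_scope.
Local Open Scope ring_scope.

(** * Trigonometry *)

(** The cosines of $\gamma$ and $\theta$ lose both signs. The third cosine records the product of
    the sines, so that only a simultaneous change of sign survives, and this is the involution in
    $G$. The invariant takes values in $\mathbb R^3$, so the compactness argument uses that $\mathbb
    R^3$ is Hausdorff and asks nothing of the quotient of representations.

    The perturbation condition ranges over all ways of writing the value at [lambdaE] as $e^{\alpha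
    Q}$, and the prescribed value at [muE] must not depend on the choice. The delicate points are
    $\pm 1$, where $Q$ is arbitrary: there oddness and periodicity force $f(\alpha)=0$. The same
    vanishing of $f$ on $\pi\mathbb Z$ makes the twist fix every corner.

    Maps out of $P$ are continuous as soon as their lifts to the plane are. The isotopy is a map out
    of $\mathbb R\times P$, which this criterion does not cover; the openness of [pil] takes its
    place. *)

Lemma periodic_int (R : realType) (T : Type) (g : R -> T) (d : R) :
  (forall x, g (x + d) = g x) -> forall x (k : int), g (x + k%:~R * d) = g x.
Proof.
move=> gd x k; have gn (n : nat) y : g (y + n%:R * d) = g y.
  elim: n y => [|n IH] y; first by rewrite mul0r addr0.
  by rewrite -natr1 mulrDl mul1r addrA gd.
case: k => n; first exact: gn.
by rewrite NegzE mulrNz mulNr -(gn n.+1 (x - _)) subrK.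
Qed.

Section Trigonometry.
Context {R : realType}.
Implicit Types x y t : R.

Lemma cosD2piz x (k : int) : cos (x + k%:~R * (2 * pi)) = cos x.
Proof. by apply: periodic_int => y; rewrite mulr_natl cosD2pi. Qed.

(** Subtracting multiples of $2\pi$ moves $x$ into $[0,2\pi)$. On $[0,\pi]$ the cosine is injective,
    and the other half is reflected there by $y\mapsto 2\pi-y$. *)
Lemma cos_eq1 x : cos x = 1 -> exists k : int, x = k%:~R * (2 * pi).
Proof.
move=> x1; have pi0 : 0 < 2 * pi :> R by rewrite mulr_gt0 ?pi_gt0.
pose k := Num.floor (x / (2 * pi)); exists k.
have kx : k%:~R * (2 * pi) <= x by rewrite -ler_pdivlMr// floor_le.
have xk : x < k%:~R * (2 * pi) + 2 * pi.
  have := floorD1_gt (x / (2 * pi)).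
  by rewrite ltr_pdivrMr// intrD mulrDl mul1r.
have cosy : cos (x - k%:~R * (2 * pi)) = 1.
  by rewrite -mulNr -mulrNz cosD2piz.
apply/eqP; rewrite -subr_eq0; apply/eqP.
move: cosy kx xk; set y := x - _ => cosy kx xk.
have y0 : 0 <= y by rewrite subr_ge0.
have yp : y < 2 * pi by rewrite /y ltrBlDl.
have piP : 0 < pi :> R by exact: pi_gt0.
have [ylepi|piley] := leP y pi.
  by apply: cos_inj; rewrite ?in_itv/= ?y0 ?ylepi ?lexx ?cos0 ?pi_ge0.
have cosz : cos (2 * pi - y) = 1.
  by rewrite mulr_natl -cosN opprB -cosD2pi subrK.
have : 2 * pi - y = 0.
  apply: cos_inj; rewrite ?cos0 ?cosz// in_itv/=; last by rewrite lexx pi_ge0.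
  by apply/andP; split; lra.
by move=> h; lra.
Qed.

Lemma cos_sin_inj x y : cos x = cos y -> sin x = sin y ->
  exists k : int, x = y + k%:~R * (2 * pi).
Proof.
move=> xyc xys; have [|k xyk] := @cos_eq1 (x - y).
  by rewrite cosB xyc xys -!expr2 cos2Dsin2.
by exists k; rewrite -xyk addrC subrK.
Qed.

(** The sign of $y$ decides between $\arccos x$ and $-\arccos x$. The bound on the angle later
    provides a compact square that covers the pillowcase. *)
Lemma polar x y : x ^+ 2 + y ^+ 2 = 1 ->
  exists t, [/\ - pi <= t <= pi, cos t = x & sin t = y].
Proof.
move=> xy; have x1 : -1 <= x <= 1.
  by apply/andP; split; have := sqr_ge0 y; nra.
have s : sin (acos x) = `|y|.
  by rewrite sin_acos// -xy addrC addKr sqrtr_sqr.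
have a0 := acos_ge0 x1; have ap := acos_lepi x1.
have [y0|y0] := leP 0 y.
  exists (acos x); rewrite acosK// s ger0_norm//; split => //.
  by rewrite ap andbT; lra.
exists (- acos x); rewrite cosN acosK// sinN s ltr0_norm// opprK; split => //.
by rewrite lerN2 ap /=; lra.
Qed.

End Trigonometry.

(** * The pillowcase *)

Lemma continuous_pair {X Y Z : topologicalType} (f : X -> Y) (g : X -> Z) :
  continuous f -> continuous g -> continuous (fun x => (f x, g x)).
Proof. by move=> fc gc x; apply: cvg_pair; [exact: fc|exact: gc]. Qed.

(** When $\sin a=0$, the angles $a$ and $-a$ have the same cosine and sine and differ by a multiple
    of $2\pi$; hence $f(a)=f(-a)=-f(a)$. *)
Lemma odd_periodic_sin0 (R : realType) (f : R -> R) (a : R) :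
  (forall x, f (- x) = - f x) -> (forall x, f (x + 2 * pi) = f x) ->
  sin a = 0 -> f a = 0.
Proof.
move=> fN fP a0; have [||k ak] := @cos_sin_inj _ a (- a).
- by rewrite cosN.
- by rewrite sinN a0 oppr0.
have : f a = - f a by rewrite {1}ak periodic_int.
by move=> h; lra.
Qed.

Section PillowcaseTopology.
Context {R : realType}.
Implicit Types p q : R * R.

Lemma orbit_translate (g t : R) (m n : int) :
  orbit_rel (g, t) (g + m%:~R * (2 * pi), t + n%:~R * (2 * pi)).
Proof.
apply/pilP; rewrite (@periodic_int _ _ (fun y => pil (_, y))); last first.
  by move=> y; apply/esym/pilP; exact: orbit_theta.
rewrite (@periodic_int _ _ (fun x => pil (x, _)))// => x.
by apply/esym/pilP; exact: orbit_gamma.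
Qed.

Lemma orbit_cos_sin p q :
  cos p.1 = cos q.1 -> sin p.1 = sin q.1 ->
  cos p.2 = cos q.2 -> sin p.2 = sin q.2 -> orbit_rel p q.
Proof.
case: p q => [g t] [g' t'] /= c1 s1 c2 s2.
have [m ->] := cos_sin_inj c1 s1; have [n ->] := cos_sin_inj c2 s2.
by apply: orbit_sym; exact: orbit_translate.
Qed.

(* The coordinates are minus the real parts of the images of ba, ca and da. *)
Definition pil_invariant p : R * R * R := (cos p.1, cos p.2, cos (p.2 - p.1)).

Lemma pil_invariant_inj p q : pil_invariant p = pil_invariant q -> orbit_rel p q.
Proof.
have sgn x y : cos x = cos y :> R -> sin x = sin y \/ sin x = - sin y.
  move=> xy; have : sin x ^+ 2 == sin y ^+ 2 by rewrite !sin2cos2 xy.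
  by rewrite eqf_sqr => /orP[] /eqP; [left|right].
case: p q => [g t] [g' t'] [] /= cg ct; rewrite !cosB cg ct => /addrI ss.
have keep : sin g = sin g' -> sin t = sin t' -> orbit_rel (g, t) (g', t').
  by move=> sg st; exact: orbit_cos_sin.
have flip : sin g = - sin g' -> sin t = - sin t' -> orbit_rel (g, t) (g', t').
  move=> sg st; apply: (orbit_trans (orbit_opp _ _)).
  by apply: orbit_cos_sin; rewrite /= ?cosN ?sinN ?sg ?st ?opprK.
have [sg|sg] := sgn _ _ cg; have [st|st] := sgn _ _ ct.
- exact: keep.
(* The signs disagree while the products of sines agree, so one sine vanishes and may be given
   either sign. *)
- have /eqP : sin g' * sin t' = 0 by move: ss; rewrite sg st; nra.
  rewrite mulf_eq0 => /orP[] /eqP z; [apply: flip|apply: keep] => //.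
    by rewrite sg z oppr0.
  by rewrite st z oppr0.
- have /eqP : sin g' * sin t' = 0 by move: ss; rewrite sg st; nra.
  rewrite mulf_eq0 => /orP[] /eqP z; [apply: keep|apply: flip] => //.
    by rewrite sg z oppr0.
  by rewrite st z oppr0.
- exact: flip.
Qed.

Lemma pil_continuous : continuous (pil : R * R -> pillowcase R).
Proof. exact: pi_continuous. Qed.

Lemma pil_surj (x : pillowcase R) : pil (repr x) = x.
Proof. exact: reprK. Qed.

Lemma pil_fundamental (x : pillowcase R) :
  exists p, [/\ - pi <= p.1 <= pi, - pi <= p.2 <= pi & pil p = x].
Proof.
pose q := repr x.
have [g [g1 gc gs]] := polar (cos2Dsin2 q.1).
have [t [t1 tc ts]] := polar (cos2Dsin2 q.2).
exists (g, t); split => //; rewrite -(pil_surj x); apply/pilP.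
exact: orbit_cos_sin.
Qed.

Lemma pillowcase_compact : compact [set: pillowcase R].
Proof.
have -> : [set: pillowcase R] = pil @` (`[- pi, pi] `*` `[- pi, pi]).
  apply/seteqP; split=> // x _.
  by have [p [p1 p2 <-]] := pil_fundamental x; exists p => //; split.
apply: continuous_compact.
  by apply: continuous_subspaceT => x; exact: pil_continuous.
by apply: compact_setX; exact: segment_compact.
Qed.

Lemma pil_lift_continuous {Z : topologicalType} (h : pillowcase R -> Z) :
  continuous (h \o pil) -> continuous h.
Proof. by move=> hc; apply/quotient_continuous. Qed.

(** The map [g] stands for an element of $G$ carrying [p] to [q]; what matters about it is that it
    is continuous and preserves every orbit. *)
Lemma orbit_relP p q : orbit_rel p q ->
  exists2 g : R * R -> R * R, continuous g &
    g p = q /\ forall x, orbit_rel x (g x).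
Proof.
pose H p q := exists2 g : R * R -> R * R, continuous g &
    g p = q /\ forall x, orbit_rel x (g x).
have Hid r : H r r.
  exists id; first by move=> x; exact: cvg_id.
  by split => // x; exact: orbit_refl.
have Htr (a b : R) g t : (forall x, orbit_rel x (x.1 + a, x.2 + b)) ->
    H (g, t) (g + a, t + b).
  move=> ab; exists (fun x => (x.1 + a, x.2 + b)) => //.
  by apply: continuous_pair => x; apply: continuousD;
    (exact: cvg_cst || exact: cvg_fst || exact: cvg_snd).
(* Both directions are carried through the induction, so that the symmetry constructor merely swaps
   them and no map has to be inverted. *)
suff : orbit_rel p q -> H p q /\ H q p by move=> h /h[].
elim=> {p q} [p|p q _ []//|p q r _ [pq qp] _ [qr rq]|g t|g t|g t].
- by split.
- have Htrans a b c : H a b -> H b c -> H a c.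
    move=> [u uc [ua uo]] [v vc [vb vo]]; exists (v \o u).
      by move=> x; apply: continuous_comp; [exact: uc|exact: vc].
    by split=> [/=|x]; [rewrite ua|exact: orbit_trans (uo x) (vo _)].
  by split; [exact: Htrans pq qr|exact: Htrans rq qp].
- split.
    rewrite -{2}[t]addr0; apply: Htr => -[x y] /=.
    by rewrite addr0; exact: orbit_gamma.
  rewrite -{2}[g](addrK (2 * pi)) -{2}[t]addr0; apply: Htr => -[x y] /=.
  rewrite addr0; apply: orbit_sym; rewrite -{2}[x](subrK (2 * pi)).
  exact: orbit_gamma.
- split.
    rewrite -{2}[g]addr0; apply: Htr => -[x y] /=.
    by rewrite addr0; exact: orbit_theta.
  rewrite -{2}[t](addrK (2 * pi)) -{2}[g]addr0; apply: Htr => -[x y] /=.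
  rewrite addr0; apply: orbit_sym; rewrite -{2}[y](subrK (2 * pi)).
  exact: orbit_theta.
- have HN (a b : R) : H (a, b) (- a, - b).
    exists (fun x => (- x.1, - x.2)).
      by apply: continuous_pair => x; apply: continuousN;
        [exact: cvg_fst|exact: cvg_snd].
    by split=> // -[x y]; exact: orbit_opp.
  by split=> //; rewrite -{2}[g]opprK -{2}[t]opprK.
Qed.

(** Near a point [q] equivalent to some [r] in [U], the saturation of [U] contains the preimage of
    [U] under a continuous orbit-preserving map that sends [q] to [r]. *)
Lemma pil_open p (A : set (R * R)) : nbhs p A -> nbhs (pil p) (pil @` A).
Proof.
rewrite nbhsE => -[U [oU Up] UA].
suff oPU : open (pil @` U).
  apply: (@filterS _ _ _ (pil @` U)); first exact: image_subset.
  by apply: open_nbhs_nbhs; split => //; exists p.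
rewrite /open/= /quotient_open openE => q [r Ur /pilP rq].
have [g gc [gq go]] := orbit_relP (orbit_sym rq).
have : nbhs q (g @^-1` U) by apply: gc; rewrite gq; exact: open_nbhs_nbhs.
apply: filterS => s gs; exists (g s) => //.
by apply/pilP/orbit_sym.
Qed.

End PillowcaseTopology.

(** * Normal form of traceless representations *)

Section PresentedHoms.
Context {X : choiceType} {rels : seq (word X * word X)} {H : groupType}.
Implicit Types rho sigma : presented rels -> H.

Lemma presented_hom_pword rho :
  (forall g h, rho (g * h)%g = (rho g * rho h)%g) ->
  forall w, rho (pword rels w) = weval (fun x => rho (pgen rels x)) w.
Proof.
move=> rhoM; have rho1 : rho (pword rels [::]) = 1%g.
  by apply: (mulIg (rho (pword rels [::]))); rewrite -rhoM pwordM mul1g.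
elim=> [//|[x b] w IH]; rewrite -cat1s -pwordM rhoM IH /=; congr (_ * _)%g.
case: b => //; apply: (mulIg (rho (pgen rels x))).
rewrite mulVg -rhoM pwordM -rho1; congr (rho _); apply/pwordP.
exact: (@word_eq_cancel _ rels [::] [::] x false).
Qed.

Lemma presented_hom_ext rho sigma :
  (forall g h, rho (g * h)%g = (rho g * rho h)%g) ->
  (forall g h, sigma (g * h)%g = (sigma g * sigma h)%g) ->
  (forall x, rho (pgen rels x) = sigma (pgen rels x)) -> rho = sigma.
Proof.
move=> rhoM sigmaM rs; apply/funext => g; rewrite -(pword_repr g).
rewrite !presented_hom_pword//; congr (weval _ _).
exact/funext.
Qed.

Lemma presented_hom_conj rho sigma (u : H) :
  (forall g h, rho (g * h)%g = (rho g * rho h)%g) ->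
  (forall g h, sigma (g * h)%g = (sigma g * sigma h)%g) ->
  (forall x, sigma (pgen rels x) = (u * rho (pgen rels x) * u^-1)%g) ->
  forall g, sigma g = (u * rho g * u^-1)%g.
Proof.
move=> rhoM sigmaM rs g; move: g; apply/funeqP/presented_hom_ext => // g h.
by rewrite rhoM !mulgA mulgVK.
Qed.

End PresentedHoms.

Section QuaternionRotations.
Context {R : realType}.
Implicit Types (u v : SU2 R) (s x y : R).

Fact qi_traceless : traceless (qi : SU2 R). Proof. by []. Qed.

Definition expi s : SU2 R := mkSU2 (expq_unit s qi_traceless).

Lemma uquat_expi s : uquat (expi s) = (cos s, sin s, 0, 0).
Proof. by rewrite [LHS]/(expq _ _) /expq /= mulr0 mulr1. Qed.

(** The half angle reflects the double cover of $SO(3)$ by $SU(2)$: this conjugation is the rotation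
    by $s$ of the plane spanned by $\mathbf j$ and $\mathbf k$. *)
Lemma uquat_conj_expi s v (v0 v1 v2 v3 : R) : uquat v = (v0, v1, v2, v3) ->
  uquat (expi (s / 2) * v * (expi (s / 2))^-1)%g =
  (v0, v1, v2 * cos s - v3 * sin s, v2 * sin s + v3 * cos s).
Proof.
move=> vE; have sE : s = s / 2 + s / 2 by field.
rewrite !uquatM uquatV uquat_expi vE /= [in RHS]sE cosD sinD.
have := cos2Dsin2 (s / 2); move: (cos _) (sin _) => c d cd.
by congr (_, _, _, _); first [ring | rewrite -[RHS]mul1r -cd; ring].
Qed.

Lemma uquat_conj_expk s v (v0 v1 v2 v3 : R) : uquat v = (v0, v1, v2, v3) ->
  uquat (expk (s / 2) * v * (expk (s / 2))^-1)%g =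
  (v0, v1 * cos s - v2 * sin s, v1 * sin s + v2 * cos s, v3).
Proof.
move=> vE; have sE : s = s / 2 + s / 2 by field.
rewrite !uquatM uquatV uquat_expk vE /= [in RHS]sE cosD sinD.
have := cos2Dsin2 (s / 2); move: (cos _) (sin _) => c d cd.
by congr (_, _, _, _); first [ring | rewrite -[RHS]mul1r -cd; ring].
Qed.

(** The angle $s$ is minus the argument of the vector $(x,y)$. The sign condition on the remaining
    coordinate is what singles out $\mathbf i$ from $-\mathbf i$ in [conj_to_qi]. *)
Lemma rotate_to_axis x y : exists s,
  x * sin s + y * cos s = 0 /\ 0 <= x * cos s - y * sin s.
Proof.
pose r := Num.sqrt (x ^+ 2 + y ^+ 2).
have xy0 : 0 <= x ^+ 2 + y ^+ 2 by rewrite addr_ge0 ?sqr_ge0.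
have r2 : r ^+ 2 = x ^+ 2 + y ^+ 2 by rewrite sqr_sqrtr.
have [r0|r0] := eqVneq r 0.
  have : x ^+ 2 + y ^+ 2 == 0 by rewrite -r2 r0 expr0n.
  rewrite paddr_eq0 ?sqr_ge0// !sqrf_eq0 => /andP[/eqP -> /eqP ->].
  by exists 0; rewrite !mul0r addr0 subr0.
have [|s [_ cs ss]] := @polar R (x / r) (- y / r).
  by rewrite !expr_div_n sqrrN -mulrDl -r2 divff// expf_neq0.
exists s; rewrite cs ss; split; first by ring.
rewrite (_ : _ - _ = r ^+ 2 / r); last by rewrite r2; ring.
by rewrite divr_ge0 ?sqr_ge0 ?sqrtr_ge0.
Qed.

Lemma rotate_collinear x y x' y' : x * y' = x' * y -> exists s,
  x * sin s + y * cos s = 0 /\ x' * sin s + y' * cos s = 0.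
Proof.
move=> xy; have [s [s0 _]] := rotate_to_axis x y.
have [x0|x0] := eqVneq x 0; last first.
  exists s; split=> //; apply: (mulfI x0); rewrite mulr0.
  have -> : x * (x' * sin s + y' * cos s) =
    x' * (x * sin s + y * cos s) + (x * y' - x' * y) * cos s by ring.
  by rewrite s0 xy subrr mulr0 mul0r addr0.
have [y0|y0] := eqVneq y 0; last first.
  exists s; split=> //; apply: (mulfI y0); rewrite mulr0.
  have -> : y * (x' * sin s + y' * cos s) =
    y' * (x * sin s + y * cos s) - (x * y' - x' * y) * sin s by ring.
  by rewrite s0 xy subrr mulr0 mul0r subr0.
(* The first vector is zero and imposes no condition, so the rotation is chosen for the second
   one. *)
have [t [t0 _]] := rotate_to_axis x' y'.
by exists t; rewrite x0 y0 !mul0r addr0.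
Qed.

Lemma tracelessE v : traceless v -> exists v1 v2 v3 : R,
  uquat v = (0, v1, v2, v3) /\ v1 ^+ 2 + v2 ^+ 2 + v3 ^+ 2 = 1.
Proof.
rewrite /traceless /qre => v0; have := uquat1 v.
case: (uquat v) v0 => [[[q0 q1] q2] q3] /= -> q1E; exists q1, q2, q3; split => //.
by rewrite -q1E; ring.
Qed.

(** A rotation about $\mathbf i$ removes the $\mathbf k$-component, then one about $\mathbf k$
    removes the $\mathbf j$-component. What remains is a nonnegative multiple of $\mathbf i$ of norm
    1. *)
Lemma conj_to_qi v : traceless v -> exists u, (u * v * u^-1)%g = qi.
Proof.
move=> /tracelessE [v1 [v2 [v3 [vE v_unit]]]].
have [s [s0 _]] := rotate_to_axis v2 v3.
have := uquat_conj_expi s vE; rewrite s0; set w2 := _ - _; set w := (_ * _)%g => wE.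
have [t [t0 tge0]] := rotate_to_axis v1 w2.
exists (expk (t / 2) * expi (s / 2))%g.
have -> : (expk (t / 2) * expi (s / 2) * v * (expk (t / 2) * expi (s / 2))^-1 =
    expk (t / 2) * w * (expk (t / 2))^-1)%g by rewrite invgM !mulgA.
apply: uquat_inj; have wtE := uquat_conj_expk t wE.
have := uquat1 (expk (t / 2) * w * (expk (t / 2))^-1)%g.
rewrite wtE t0 uquat_qi /= => w_unit; congr (_, _, _, _).
by move: w_unit tge0; move: (v1 * _ - _) => z; nra.
Qed.

Lemma planar_traceless v (v1 v2 : R) : uquat v = (0, v1, v2, 0) ->
  exists g, v = (expk g * qi)%g.
Proof.
move=> vE; have := uquat1 v; rewrite vE /= => v_unit.
have [|g [_ gc gs]] := @polar R v1 v2; first by rewrite -v_unit; ring.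
exists g; apply: uquat_inj; rewrite !uquatE vE gc gs /=.
by congr (_, _, _, _); ring.
Qed.

(* Once a is conjugated to i, the vanishing of Re(d) = Re(c^-1 b i) says that
   the (j, k)-components of b and c are collinear, so that a rotation about i
   brings both into the plane spanned by i and j. *)
Lemma pillowcase_normal_form (a b c d : SU2 R) :
  traceless a -> traceless b -> traceless c -> traceless d ->
  (b * a = c * d)%g ->
  exists u p, [/\ pil_img p pa = (u * a * u^-1)%g,
    pil_img p pb = (u * b * u^-1)%g, pil_img p pc = (u * c * u^-1)%g
    & pil_img p pd = (u * d * u^-1)%g].
Proof.
move=> a0 b0 c0 d0 bacd; have [u ua] := conj_to_qi a0.
have [b1 [b2 [b3 [bE _]]]] := tracelessE (tracelessJ u b0).
have [c1 [c2 [c3 [cE _]]]] := tracelessE (tracelessJ u c0).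
have dE : d = (c^-1 * (b * a))%g by rewrite bacd mulKg.
have udE : (u * d * u^-1 = (u * c * u^-1)^-1 * ((u * b * u^-1) * qi))%g.
  by rewrite -ua dE !invgM invgK !mulgA !mulgVK.
have bc : b2 * c3 = c2 * b3.
  have := tracelessJ u d0.
  rewrite udE /traceless uquatM uquatV (uquatM _ qi) bE cE uquat_qi /qre /=.
  by move=> h; lra.
have [s [bs cs]] := rotate_collinear bc.
have := uquat_conj_expi s bE; have := uquat_conj_expi s cE.
rewrite bs cs => /planar_traceless [t tE] /planar_traceless [g gE].
pose v := (expi (s / 2) * u)%g.
have vE (x : SU2 R) :
    (v * x * v^-1 = expi (s / 2) * (u * x * u^-1) * (expi (s / 2))^-1)%g.
  by rewrite /v invgM !mulgA.
have va : (v * a * v^-1)%g = qi.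
  rewrite vE ua; apply: uquat_inj.
  by rewrite (uquat_conj_expi _ uquat_qi) !mul0r addr0 subr0.
have vb : (v * b * v^-1 = expk g * qi)%g by rewrite vE gE.
have vc : (v * c * v^-1 = expk t * qi)%g by rewrite vE tE.
exists v, (g, t); split; rewrite ?va ?vb ?vc//=.
(* The relation $ba=cd$ holds on both sides and determines $d$ from the other three, so matching
   $a$, $b$ and $c$ suffices. *)
have /= := @pil_img_rels R (g, t) _ (mem_head _ _); rewrite !mulg1 => /= h.
have -> : (expk (t - g) * qi = (expk t * qi)^-1 * (expk g * qi * qi))%g.
  by rewrite h mulKg.
rewrite -vb -vc -va dE; clearbody v.
by rewrite !invgM invgK !mulgA !mulgVK.
Qed.

End QuaternionRotations.

(** * Continuity *)

Section Continuity.
Context {X : topologicalType}.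

Lemma continuous_set_type {T : topologicalType} (A : set T) (h : X -> A) :
  continuous (\val \o h) -> continuous h.
Proof. by move=> hc; apply: (@continuous_comp_initial _ _ _ set_val). Qed.

Lemma continuous_val {T : topologicalType} (A : set T) :
  continuous (\val : A -> T).
Proof. exact: (@initial_continuous _ _ set_val). Qed.

Lemma continuous_ptws {G : Type} {V : topologicalType} (h : X -> {ptws G -> V}) :
  (forall g, continuous (fun x => h x g)) -> continuous h.
Proof.
move=> hc x; apply/cvg_sup => g; apply: (@continuous_comp_initial _ _ _ _ h).
exact: hc.
Qed.

Lemma continuous_ptws_eval {G : Type} {V : topologicalType} (g : G)
    (h : X -> {ptws G -> V}) : continuous h -> continuous (fun x => h x g).
Proof.
move=> hc x B nB; apply: (hc x [set k | B (k g)]).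
have /cvg_sup/(_ g) hg : nbhs (h x) --> h x by exact: cvg_id.
apply: hg; exact: (@initial_continuous _ _ (fun k : {ptws G -> V} => k g) _ _ nB).
Qed.

Context {R : realType}.
Implicit Types a b : X -> R.

Lemma continuous_addr a b :
  continuous a -> continuous b -> continuous (fun x => a x + b x).
Proof. by move=> ac bc x; apply: continuousD; [exact: ac|exact: bc]. Qed.

Lemma continuous_oppr a : continuous a -> continuous (fun x => - a x).
Proof. by move=> ac x; apply: continuousN; exact: ac. Qed.

Lemma continuous_mulr a b :
  continuous a -> continuous b -> continuous (fun x => a x * b x).
Proof. by move=> ac bc x; apply: continuousM; [exact: ac|exact: bc]. Qed.

Lemma continuous_quat (q0 q1 q2 q3 : X -> R) :
  continuous q0 -> continuous q1 -> continuous q2 -> continuous q3 ->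
  continuous (fun x => (q0 x, q1 x, q2 x, q3 x) : quat R).
Proof. by move=> *; do 3!apply: continuous_pair => //. Qed.

Lemma continuous_su2 (u : X -> SU2 R) :
  continuous (fun x => uquat (u x)) -> continuous u.
Proof. by move=> uc; exact: continuous_set_type. Qed.

Lemma continuous_uquat (u : X -> SU2 R) :
  continuous u -> continuous (fun x => uquat (u x)).
Proof.
by move=> uc x; apply: continuous_comp; [exact: uc|exact: continuous_val].
Qed.

Lemma continuous_quat_coords (q : X -> quat R) : continuous q ->
  [/\ continuous (fun x => (q x).1.1.1), continuous (fun x => (q x).1.1.2),
      continuous (fun x => (q x).1.2) & continuous (fun x => (q x).2)].
Proof.
have fstc (Y Z : topologicalType) (h : X -> Y * Z) :
    continuous h -> continuous (fun x => (h x).1).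
  by move=> hc x; apply: (@continuous_comp _ _ _ h); [exact: hc|exact: cvg_fst].
have sndc (Y Z : topologicalType) (h : X -> Y * Z) :
    continuous h -> continuous (fun x => (h x).2).
  by move=> hc x; apply: (@continuous_comp _ _ _ h); [exact: hc|exact: cvg_snd].
move=> qc; have q1c := fstc _ _ _ qc; have q2c := fstc _ _ _ q1c.
by split; [exact: fstc q2c|exact: sndc q2c|exact: sndc q1c|exact: sndc qc].
Qed.

Lemma continuous_su2_mul (u v : X -> SU2 R) :
  continuous u -> continuous v -> continuous (fun x => u x * v x)%g.
Proof.
move=> /continuous_uquat uc /continuous_uquat vc; apply: continuous_su2.
have [u0 u1 u2 u3] := continuous_quat_coords uc.
have [v0 v1 v2 v3] := continuous_quat_coords vc.
rewrite (_ : (fun x => _) = fun x =>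
  let p := uquat (u x) in let q := uquat (v x) in
  (p.1.1.1 * q.1.1.1 - p.1.1.2 * q.1.1.2 - p.1.2 * q.1.2 - p.2 * q.2,
   p.1.1.1 * q.1.1.2 + p.1.1.2 * q.1.1.1 + p.1.2 * q.2 - p.2 * q.1.2,
   p.1.1.1 * q.1.2 - p.1.1.2 * q.2 + p.1.2 * q.1.1.1 + p.2 * q.1.1.2,
   p.1.1.1 * q.2 + p.1.1.2 * q.1.2 - p.1.2 * q.1.1.2 + p.2 * q.1.1.1)); last first.
  apply/funext => x; rewrite uquatM.
  by case: (uquat _) => [[[? ?] ?] ?]; case: (uquat _) => [[[? ?] ?] ?].
by apply: continuous_quat; repeat first
  [exact: continuous_mulr|apply: continuous_addr|apply: continuous_oppr].
Qed.

Lemma continuous_su2_inv (u : X -> SU2 R) :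
  continuous u -> continuous (fun x => (u x)^-1)%g.
Proof.
move=> /continuous_uquat /continuous_quat_coords[u0 u1 u2 u3].
apply: continuous_su2.
rewrite (_ : (fun x => _) = fun x =>
  let q := uquat (u x) in (q.1.1.1, - q.1.1.2, - q.1.2, - q.2)); last first.
  by apply/funext => x; rewrite uquatV; case: (uquat _) => [[[? ?] ?] ?].
by apply: continuous_quat => //; exact: continuous_oppr.
Qed.

Lemma continuous_weval {Y : choiceType} (phi : X -> Y -> SU2 R) :
  (forall y, continuous (phi ^~ y)) ->
  forall w, continuous (fun x => weval (phi x) w).
Proof.
move=> phic; elim=> [|[y b] w IH] /=; first by move=> x; exact: cvg_cst.
apply: continuous_su2_mul => //; case: b; first exact: phic.
by apply: continuous_su2_inv; exact: phic.
Qed.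

Lemma continuous_expk a : continuous a -> continuous (fun x => expk (a x)).
Proof.
move=> ac; apply: continuous_su2.
under [X in continuous X]eq_fun do rewrite uquat_expk.
apply: continuous_quat => x; first last.
- by apply: (@continuous_comp _ _ _ a sin); [exact: ac|exact: continuous_sin].
- exact: cvg_cst.
- exact: cvg_cst.
- by apply: (@continuous_comp _ _ _ a cos); [exact: ac|exact: continuous_cos].
Qed.

End Continuity.

Lemma continuous_plift {R : realType} {X : topologicalType} {Y : choiceType}
    (rels : seq (word Y * word Y)) (phi : X -> Y -> SU2 R) :
  (forall y, continuous (phi ^~ y)) ->
  continuous (fun x => plift (phi x) : {ptws presented rels -> SU2 R}).
Proof.
by move=> phic; apply: continuous_ptws => g; exact: continuous_weval.
Qed.

Section ConjugacyClasses.
Context {R : realType} {G : Type} {A : set {ptws G -> SU2 R}}.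

Lemma conj_class_continuous : continuous (@conj_class R G A).
Proof. exact: pi_continuous. Qed.

Lemma conj_class_lift_continuous {Z : topologicalType} (h : conj_classes A -> Z) :
  continuous (h \o @conj_class R G A) -> continuous h.
Proof. by move=> hc; apply/quotient_continuous. Qed.

Lemma conj_class_surj (c : conj_classes A) : conj_class (repr c) = c.
Proof. exact: reprK. Qed.

Lemma continuous_eval (g : G) : continuous (fun rho : A => \val rho g).
Proof.
by apply: (@continuous_ptws_eval A _ _ g \val); exact: continuous_val.
Qed.

End ConjugacyClasses.

(** * The homeomorphism from the pillowcase to the character variety *)

Section SphereRepresentations.
Context {R : realType}.

Lemma sphere_repP (rho : sphere_reps (R := R)) :
  (forall g h, \val rho (g * h)%g = (\val rho g * \val rho h)%g) /\
  (forall x, traceless (\val rho (smer x))).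
Proof. by have := svalP rho; rewrite inE. Qed.

Lemma sphere_conj_class (rho sigma : sphere_reps (R := R)) (u : SU2 R) :
  (forall x, \val sigma (smer x) = (u * \val rho (smer x) * u^-1)%g) ->
  conj_class rho = conj_class sigma.
Proof.
move=> rs; apply/conj_classP; exists u.
apply: presented_hom_conj rs; first exact: (sphere_repP rho).1.
exact: (sphere_repP sigma).1.
Qed.

Lemma pil_rep_smer (p : R * R) (x : puncture) :
  \val (pil_rep p) (smer x) = pil_img p x.
Proof. exact: (plift_gen (@pil_img_rels R p)). Qed.

Lemma continuous_pil_img (x : puncture) : continuous (fun p : R * R => pil_img p x).
Proof.
have qic : continuous (fun _ : R * R => qi : SU2 R) by move=> p; exact: cvg_cst.
have p1c : continuous (fun p : R * R => p.1) by move=> p; exact: cvg_fst.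
have p2c : continuous (fun p : R * R => p.2) by move=> p; exact: cvg_snd.
case: x => //=; apply: continuous_su2_mul => //; apply: continuous_expk => //.
by apply: continuous_addr => //; exact: continuous_oppr.
Qed.

Lemma pil_to_R_continuous : continuous (pil_to_R : pillowcase R -> sphere_R R).
Proof.
apply: pil_lift_continuous.
rewrite (_ : _ \o _ = @conj_class _ _ _ \o pil_rep); last first.
  by apply/funext => p /=; rewrite pil_to_RE.
move=> p; apply: continuous_comp; last exact: conj_class_continuous.
apply: continuous_set_type; apply: continuous_plift => x.
exact: continuous_pil_img.
Qed.

Lemma pil_to_R_surj (c : sphere_R R) : exists x, pil_to_R x = c.
Proof.
rewrite -(conj_class_surj c); move: (repr c) => rho.
have [rhoM rho0] := sphere_repP rho.
have bacd : (\val rho (smer pb) * \val rho (smer pa) =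
    \val rho (smer pc) * \val rho (smer pd))%g.
  rewrite -!rhoM; congr (\val rho _); rewrite /smer /pgen !pwordM; apply/pwordP.
  exact: (@word_eq_rel _ sphere_rels [::] [::] _ (mem_head _ _)).
have [u [p [pA pB pC pD]]] :=
  pillowcase_normal_form (rho0 pa) (rho0 pb) (rho0 pc) (rho0 pd) bacd.
exists (pil p); rewrite pil_to_RE; apply/esym/(@sphere_conj_class _ _ u) => x.
by rewrite pil_rep_smer; case: x.
Qed.

Definition rep_invariant (rho : sphere_reps (R := R)) : R * R * R :=
  let t x := - qre (uquat (\val rho (smer x) * \val rho (smer pa))%g) in
  (t pb, t pc, t pd).

Definition conj_invariant (c : sphere_R R) : R * R * R := rep_invariant (repr c).

Lemma conj_invariantE (rho : sphere_reps (R := R)) :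
  conj_invariant (conj_class rho) = rep_invariant rho.
Proof.
have : conj_rel (repr (conj_class rho)) rho by exact: equiv_rel_of_repr.
rewrite /conj_invariant; move: (repr _) => sigma [u rs].
rewrite /rep_invariant !rs.
have qreJ (a b : SU2 R) :
    qre (uquat (u * a * u^-1 * (u * b * u^-1))%g) = qre (uquat (a * b)%g).
  have -> : (u * a * u^-1 * (u * b * u^-1) = u * (a * b * u^-1))%g.
    by rewrite !mulgA mulgVK.
  by rewrite uquatM qre_mulC -uquatM mulgVK.
by rewrite !qreJ.
Qed.

Lemma conj_invariant_continuous : continuous conj_invariant.
Proof.
apply: conj_class_lift_continuous.
rewrite (_ : _ \o _ = rep_invariant); last first.
  by apply/funext => rho /=; rewrite conj_invariantE.
have tc x : continuous (fun rho : sphere_reps (R := R) =>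
    - qre (uquat (\val rho (smer x) * \val rho (smer pa))%g)).
  apply: continuous_oppr.
  have /continuous_uquat/continuous_quat_coords[//] :
    continuous (fun rho : sphere_reps (R := R) =>
      (\val rho (smer x) * \val rho (smer pa))%g).
  by apply: continuous_su2_mul; exact: continuous_eval.
by do 2!apply: continuous_pair => //.
Qed.

Lemma conj_invariant_pil (p : R * R) :
  conj_invariant (pil_to_R (pil p)) = pil_invariant p.
Proof.
rewrite pil_to_RE conj_invariantE /rep_invariant !pil_rep_smer /= !uquatE /qre /=.
by rewrite /pil_invariant; congr (_, _, _); ring.
Qed.

Lemma conj_invariant_inj : injective (conj_invariant \o pil_to_R).
Proof.
move=> x y /=; rewrite -(pil_surj x) -(pil_surj y) !conj_invariant_pil.
by move=> /pil_invariant_inj xy; apply/pilP.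
Qed.

Lemma pil_to_R_inj : injective (pil_to_R : pillowcase R -> sphere_R R).
Proof. by move=> x y xy; apply: conj_invariant_inj; rewrite /= xy. Qed.

Lemma pil_to_R_homeomorphism : homeomorphism (pil_to_R : pillowcase R -> sphere_R R).
Proof.
split; first exact: pil_to_R_continuous.
have [g gK] := choice pil_to_R_surj.
exists g; split=> //; first by move=> x; apply: pil_to_R_inj; rewrite gK.
apply/continuous_closedP => A cA.
(* Since [conj_invariant \o pil_to_R] is injective, the preimage of [A] under [g] can be read off in
   $\mathbb R^3$, where the image of [A] is compact and therefore closed. *)
rewrite (_ : g @^-1` A =
    conj_invariant @^-1` ((conj_invariant \o pil_to_R) @` A)); last first.
  apply/seteqP; split=> c /=; first by move=> gcA; exists (g c); rewrite ?gK.
  move=> [x Ax]; rewrite -{1}(gK c) => /conj_invariant_inj.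
  by move=> <-.
move/continuous_closedP: conj_invariant_continuous; apply.
apply: compact_closed; first exact: norm_hausdorff.
apply: continuous_compact; last first.
  exact: subclosed_compact cA pillowcase_compact _.
apply: continuous_subspaceT => x; apply: continuous_comp.
  exact: pil_to_R_continuous.
exact: conj_invariant_continuous.
Qed.

End SphereRepresentations.

(** * Representations of the perturbed cobordism *)

Section QuaternionExponential.
Context {R : realType}.

(** This makes the perturbation condition apply to every representation: the value at [lambdaE]
    always has the form that it asks for. *)
Lemma expq_surj (v : SU2 R) :
  exists alpha Q, traceless Q /\ uquat v = expq alpha Q.
Proof.
have := uquat1 v; case vE : (uquat v) => [[[v0 v1] v2] v3] /= v_unit.
pose r := Num.sqrt (v1 ^+ 2 + v2 ^+ 2 + v3 ^+ 2).
have r2 : r ^+ 2 = v1 ^+ 2 + v2 ^+ 2 + v3 ^+ 2.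
  by rewrite sqr_sqrtr// !addr_ge0 ?sqr_ge0.
have [|alpha [_ ac as_]] := @polar R v0 r; first by rewrite r2 !addrA.
(* At $v=\pm1$ the axis is undetermined and any traceless unit quaternion serves. *)
exists alpha; have [r0|r0] := eqVneq r 0.
  exists qi; split=> //; rewrite /expq uquat_qi ac as_ r0 !mul0r.
  move: r2; rewrite r0 expr0n/= => /esym/eqP.
  rewrite !paddr_eq0 ?addr_ge0 ?sqr_ge0// !sqrf_eq0.
  by move=> /andP[/andP[/eqP -> /eqP ->] /eqP ->].
have Q1 : qnorm2 ((0, v1 / r, v2 / r, v3 / r) : quat R) = 1.
  by rewrite /= !expr_div_n expr0n add0r -!mulrDl -r2 divff// expf_neq0.
exists (mkSU2 Q1); split=> //.
have Q1E : uquat (mkSU2 Q1) = (0, v1 / r, v2 / r, v3 / r) by [].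
rewrite /expq Q1E ac as_.
by congr (_, _, _, _); rewrite mulrC divfK.
Qed.

Lemma expq_conj (alpha : R) (u Q v : SU2 R) : traceless Q ->
  uquat v = expq alpha Q ->
  uquat (u * v * u^-1)%g = expq alpha (u * Q * u^-1)%g.
Proof.
move=> /tracelessE[q1 [q2 [q3 [QE _]]]] vE.
rewrite /expq !uquatM uquatV vE /expq QE.
have := uquat1 u; case: (uquat u) => [[[u0 u1] u2] u3] /= u_unit.
(* The real part is multiplied by $|u|^2=1$; writing the factor 1 as $|u|^2$ turns it into a
   polynomial identity. *)
by congr (_, _, _, _); [rewrite -[RHS]mul1r -u_unit|..]; ring.
Qed.

(* e^{beta k} determines (alpha, Q) up to (alpha + 2 pi k, Q) and (- alpha, - Q),
   except where sin alpha = 0, in which case f alpha = 0. *)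
Lemma expq_expk (f : R -> R) (beta alpha : R) (Q : SU2 R) :
  (forall x, f (- x) = - f x) -> (forall x, f (x + 2 * pi) = f x) ->
  traceless Q -> uquat (expk beta) = expq alpha Q ->
  uquat (expk (f beta)) = expq (f alpha) Q.
Proof.
move=> fN fP /tracelessE[q1 [q2 [q3 [QE Q1]]]]; rewrite !uquat_expk /expq QE.
move=> [ba q1a q2a q3a].
have [sa0|sa0] := eqVneq (sin alpha) 0.
  have sb0 : sin beta = 0 by rewrite q3a sa0 mul0r.
  by rewrite !(odd_periodic_sin0 fN fP)// cos0 sin0 !mul0r.
have q10 : q1 = 0 by apply: (mulfI sa0); rewrite mulr0.
have q20 : q2 = 0 by apply: (mulfI sa0); rewrite mulr0.
have /eqP : q3 ^+ 2 = 1 ^+ 2 by rewrite -[RHS]/(1 * 1) mul1r -Q1 q10 q20; ring.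
rewrite q10 q20 !mulr0 eqf_sqr => /orP[] /eqP q3E.
  rewrite q3E mulr1 in q3a *.
  have [k ->] := cos_sin_inj ba q3a.
  by rewrite (periodic_int fP) mulr1.
rewrite q3E mulrN1 in q3a *.
have [||k ->] := @cos_sin_inj _ beta (- alpha); rewrite ?cosN ?sinN//.
by rewrite (periodic_int fP) fN cosN sinN mulrN1.
Qed.

End QuaternionExponential.

Section Cobordism.
Context {R : realType} (f : R -> R).
Hypotheses (f_odd : forall x, f (- x) = - f x)
  (f_periodic : forall x, f (x + 2 * pi) = f x).

Lemma cobordism_repP (rho : cobordism_reps f) :
  [/\ forall g h, \val rho (g * h)%g = (\val rho g * \val rho h)%g,
      forall x, traceless (\val rho (cmer x)) &
      forall (alpha : R) (Q : SU2 R), traceless Q ->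
        uquat (\val rho lambdaE) = expq alpha Q ->
        uquat (\val rho muE) = expq (f alpha) Q].
Proof. by have := svalP rho; rewrite inE. Qed.

Lemma incl0_smer x : incl0 (smer x) = cmer x.
Proof. exact: (plift_gen end0_rels). Qed.

Lemma incl1_smer x : incl1 (smer x) = end1_mer x.
Proof. exact: (plift_gen end1_rels). Qed.

Definition cob_img (p : R * R) (x : cobordism_gen) : SU2 R :=
  match x with
  | mer y => pil_img p y
  | muE_gen => expk (f (p.1 + pi))
  end.

(** The shift by $\pi$ comes from $\mathbf i\,\mathbf i=-1=e^{\pi\mathbf k}$. *)
Lemma pil_img_ba (p : R * R) :
  (pil_img p pb * pil_img p pa)%g = expk (p.1 + pi).
Proof.
apply: uquat_inj; rewrite /= !uquatE /= cosDpi sinDpi.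
by congr (_, _, _, _); ring.
Qed.

Lemma expkC (x y : R) : (expk x * expk y)%g = (expk y * expk x)%g.
Proof. by apply: uquat_inj; rewrite !uquatE /=; congr (_, _, _, _); ring. Qed.

Lemma cob_img_rels p r : r \in cobordism_rels ->
  weval (cob_img p) r.1 = weval (cob_img p) r.2.
Proof.
rewrite !inE => /orP[] /eqP -> /=; rewrite !mulg1.
  by have := @pil_img_rels R p _ (mem_head _ _); rewrite /= !mulg1.
have /= ba := pil_img_ba p.
by rewrite ba [RHS]mulgA ba expkC.
Qed.

Lemma plift_cmer p x : plift (cob_img p) (cmer x) = pil_img p x.
Proof. exact: (plift_gen (@cob_img_rels p)). Qed.

Lemma plift_muE p : plift (cob_img p) muE = expk (f (p.1 + pi)).
Proof. exact: (plift_gen (@cob_img_rels p)). Qed.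

Lemma cob_rep_subproof p : cobordism_reps f (plift (cob_img p)).
Proof.
have liftM := pliftM (@cob_img_rels p).
split=> [g h|x|alpha Q Q0]; first exact: liftM.
  rewrite plift_cmer -pil_rep_smer; exact: (sphere_repP (pil_rep p)).2.
rewrite [plift _ lambdaE]liftM !plift_cmer pil_img_ba plift_muE.
exact: expq_expk.
Qed.

Definition cob_rep (p : R * R) : cobordism_reps f :=
  exist _ (plift (cob_img p)) (mem_set (cob_rep_subproof p)).

Lemma restrict_end0_cob_rep p :
  restrict_end0 (conj_class (cob_rep p)) = pil_to_R (pil p).
Proof.
rewrite restrict_end0E pil_to_RE; apply: (@sphere_conj_class _ _ _ 1%g) => x.
by rewrite mul1g invg1 mulg1 pil_rep_smer /= incl0_smer plift_cmer.
Qed.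

Lemma restrict_end1_cob_rep (gamma theta : R) :
  restrict_end1 (conj_class (cob_rep (gamma, theta))) =
  pil_to_R (pil (gamma, theta + 2 * f (gamma + pi))).
Proof.
have [repM _ _] := cobordism_repP (cob_rep (gamma, theta)).
have muV : (plift (cob_img (gamma, theta)) muE^-1 = (expk (f (gamma + pi)))^-1)%g.
  apply: (mulIg (expk (f (gamma + pi)))); rewrite mulVg.
  rewrite -(plift_muE (gamma, theta)) -[LHS]repM mulVg.
  by rewrite /= (plift_pword (@cob_img_rels _)).
have repJ x : plift (cob_img (gamma, theta)) (muE * cmer x * muE^-1)%g =
    (expk (f (gamma + pi)) * pil_img (gamma, theta) x *
     (expk (f (gamma + pi)))^-1)%g.
  by rewrite [LHS]repM [X in (X * _)%g]repM /= muV plift_muE plift_cmer.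
(* As $\mathbf i$ anticommutes with $\mathbf k$, the factor $e^{-\varphi\mathbf k}$ becomes
   $e^{\varphi\mathbf k}$ when moved across $\mathbf i$. This is the origin of the factor 2 in
   $c_\delta$. *)
have turn (phi x : R) :
    (expk phi * (expk x * qi) * (expk phi)^-1 = expk (x + 2 * phi) * qi)%g.
  apply: uquat_inj; rewrite !uquatE mulr_natl mulr2n /= !(cosD, sinD).
  by congr (_, _, _, _); ring.
rewrite restrict_end1E pil_to_RE; apply: (@sphere_conj_class _ _ _ 1%g) => x.
rewrite mul1g invg1 mulg1 pil_rep_smer /= incl1_smer.
case: x; rewrite /= ?plift_cmer //.
- by rewrite repJ /= turn.
- by rewrite repJ /= turn; congr (expk _ * _)%g; ring.
Qed.

(* The value at muE is determined by the value at lambdaE, equivariantly under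
   conjugation. *)
Lemma restrict_end0_inj : injective (@restrict_end0 R f).
Proof.
move=> c d; rewrite -(conj_class_surj c) -(conj_class_surj d) !restrict_end0E.
move: (repr c) (repr d) => rho sigma /conj_classP[u rs]; apply/conj_classP.
have [rhoM rho0 rhoE] := cobordism_repP rho.
have [sigmaM sigma0 sigmaE] := cobordism_repP sigma.
have rsmer x : \val sigma (cmer x) = (u * \val rho (cmer x) * u^-1)%g.
  by have := rs (smer x); rewrite /= incl0_smer.
exists u; apply: presented_hom_conj => // -[x|]; first exact: rsmer.
have [alpha [Q [Q0 lQ]]] := expq_surj (\val rho lambdaE).
apply: uquat_inj; rewrite -/muE.
rewrite (expq_conj u Q0 (rhoE _ _ Q0 lQ)).
apply: sigmaE; first exact: tracelessJ.
rewrite -(expq_conj u Q0 lQ); congr (uquat _).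
by rewrite [LHS]sigmaM !rsmer [\val rho lambdaE]rhoM !mulgA mulgVK.
Qed.

Lemma restrict_end0_continuous : continuous (@restrict_end0 R f).
Proof.
apply: conj_class_lift_continuous.
rewrite (_ : _ \o _ = @conj_class _ _ _ \o @restrict0_rep R f); last first.
  by apply/funext => rho /=; rewrite restrict_end0E.
move=> rho; apply: continuous_comp; last exact: conj_class_continuous.
apply: continuous_set_type; apply: continuous_ptws => g.
exact: continuous_eval.
Qed.

Definition pil_to_cobordism (x : pillowcase R) : cobordism_R f :=
  conj_class (cob_rep (repr x)).

Lemma restrict_end0_pil_to_cobordism x :
  restrict_end0 (pil_to_cobordism x) = pil_to_R x.
Proof. by rewrite /pil_to_cobordism restrict_end0_cob_rep pil_surj. Qed.

(** Independence of the chosen representative follows from the injectivity of restriction to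
    $S^2\times\{0\}$, without exhibiting conjugating elements. *)
Lemma pil_to_cobordismE p : pil_to_cobordism (pil p) = conj_class (cob_rep p).
Proof.
apply: restrict_end0_inj.
by rewrite restrict_end0_pil_to_cobordism restrict_end0_cob_rep.
Qed.

(** The inverse is restriction to $S^2\times\{0\}$ followed by the inverse of [pil_to_R]; both are
    continuous already. *)
Lemma pil_to_cobordism_homeomorphism :
  continuous f -> homeomorphism pil_to_cobordism.
Proof.
move=> fc; have [pc [g [pK gK gc]]] := @pil_to_R_homeomorphism R.
split.
  apply: pil_lift_continuous.
  rewrite (_ : _ \o _ = @conj_class _ _ _ \o cob_rep); last first.
    by apply/funext => p /=; rewrite pil_to_cobordismE.
  move=> p; apply: continuous_comp; last exact: conj_class_continuous.
  apply: continuous_set_type; apply: continuous_plift => -[x|].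
    exact: continuous_pil_img.
  apply: continuous_expk => {}p.
  apply: (@continuous_comp _ _ _ (fun p : R * R => p.1 + pi)); last exact: fc.
  by apply: continuousD; [exact: cvg_fst|exact: cvg_cst].
exists (g \o @restrict_end0 R f); split=> [x|c|c].
- by rewrite /= restrict_end0_pil_to_cobordism pK.
- by apply: restrict_end0_inj; rewrite restrict_end0_pil_to_cobordism /= gK.
- by apply: continuous_comp; [exact: restrict_end0_continuous|exact: gc].
Qed.

Lemma restrict_ends_pil_to_cobordism x :
  restrict_ends (pil_to_cobordism x) = (pil_to_R x, pil_to_R (cdelta f x)).
Proof.
rewrite /restrict_ends restrict_end0_pil_to_cobordism; congr (_, _).
rewrite -(pil_surj x); case: (repr x) => g t.
by rewrite pil_to_cobordismE restrict_end1_cob_rep cdeltaE.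
Qed.

End Cobordism.

(** * The twist of the pillowcase *)

Section CdeltaHomeomorphism.
Context {R : realType}.

(** The twist by $-f$ is the inverse, since $\gamma$ is left unchanged. *)
Lemma cdelta_homeomorphism (f : R -> R) :
  (forall x, f (- x) = - f x) -> (forall x, f (x + 2 * pi) = f x) ->
  continuous f -> homeomorphism (cdelta f).
Proof.
have cdelta_continuous (g : R -> R) : (forall x, g (- x) = - g x) ->
    (forall x, g (x + 2 * pi) = g x) -> continuous g -> continuous (cdelta g).
  move=> gN gP gc; apply: pil_lift_continuous.
  rewrite (_ : _ \o _ = pil \o (fun p : R * R => (p.1, p.2 + 2 * g (p.1 + pi)))).
    move=> p; apply: continuous_comp; last exact: pil_continuous.
    move: p; apply: continuous_pair; first by move=> p; exact: cvg_fst.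
    apply: continuous_addr; first by move=> p; exact: cvg_snd.
    apply: continuous_mulr => p; first exact: cvg_cst.
    apply: (@continuous_comp _ _ _ (fun p : R * R => p.1 + pi)); last exact: gc.
    by apply: continuousD; [exact: cvg_fst|exact: cvg_cst].
  by apply/funext => -[x y] /=; rewrite cdeltaE.
have cdeltaK (g h : R -> R) : (forall x, g (- x) = - g x) ->
    (forall x, g (x + 2 * pi) = g x) -> (forall x, h (- x) = - h x) ->
    (forall x, h (x + 2 * pi) = h x) -> (forall x, h x = - g x) ->
    cancel (cdelta g) (cdelta h).
  move=> gN gP hN hP hg x; rewrite -(pil_surj x); case: (repr x) => a b.
  by rewrite [cdelta g _]cdeltaE// cdeltaE// hg mulrN addrK.
move=> fN fP fc; split; first exact: cdelta_continuous.
have NfN x : - f (- x) = - - f x by rewrite fN.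
have NfP x : - f (x + 2 * pi) = - f x by rewrite fP.
exists (cdelta (fun x => - f x)); split.
- exact: cdeltaK.
- by apply: cdeltaK => // x; rewrite opprK.
- by apply: cdelta_continuous => //; exact: continuous_oppr.
Qed.

Lemma cdelta_isotopy (f : R -> R) :
  (forall x, f (- x) = - f x) -> (forall x, f (x + 2 * pi) = f x) ->
  continuous f -> isotopy (fun t : R => cdelta (fun x => t * f x)) id (cdelta f).
Proof.
move=> fN fP fc.
have tfN t x : t * f (- x) = - (t * f x) by rewrite fN mulrN.
have tfP t x : t * f (x + 2 * pi) = t * f x by rewrite fP.
split.
- apply: continuous_subspaceT => -[t x]; rewrite -(pil_surj x).
  move: (repr x) => p {x} W nW.
  pose flow (z : R * (R * R)) : pillowcase R :=
    pil (z.2.1, z.2.2 + 2 * (z.1 * f (z.2.1 + pi))).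
  have flowE z : flow z = cdelta (fun x => z.1 * f x) (pil z.2).
    by case: z => s [a b]; rewrite cdeltaE.
  have flow_continuous : continuous flow.
    have z1c : continuous (fun z : R * (R * R) => z.1) by move=> z; exact: cvg_fst.
    have z2c : continuous (fun z : R * (R * R) => z.2) by move=> z; exact: cvg_snd.
    have z21c : continuous (fun z : R * (R * R) => z.2.1).
      move=> z; apply: (@continuous_comp _ _ _ snd fst); first exact: z2c.
      exact: cvg_fst.
    have z22c : continuous (fun z : R * (R * R) => z.2.2).
      move=> z; apply: (@continuous_comp _ _ _ snd snd); first exact: z2c.
      exact: cvg_snd.
    move=> z; apply: continuous_comp; last exact: pil_continuous.
    move: z; apply: continuous_pair => //; apply: continuous_addr => //.
    apply: continuous_mulr; first by move=> z; exact: cvg_cst.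
    apply: continuous_mulr => // z.
    apply: (@continuous_comp _ _ _ (fun z : R * (R * R) => z.2.1 + pi)); last exact: fc.
    by apply: continuousD; [exact: z21c|exact: cvg_cst].
  have : nbhs (t, p) (flow @^-1` W) by apply: flow_continuous; rewrite flowE.
  move=> -[[A B] /= [nA nB] AB]; exists (A, pil @` B) => /=.
    by split=> //; exact: pil_open.
  by move=> [s _] [/= As [q Bq <-]]; rewrite -(flowE (s, q)); exact: AB.
- move=> t _; apply: cdelta_homeomorphism => // x.
  by apply: continuousM; [exact: cvg_cst|exact: fc].
- apply/funext => x /=; rewrite -(pil_surj x); case: (repr x) => a b.
  by rewrite cdeltaE// mul0r mulr0 addr0.
- by congr cdelta; apply/funext => x; rewrite mul1r.
Qed.

End CdeltaHomeomorphism.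

(** * Smoothness of the twist away from the corners *)

Section CdeltaSmooth.
Context {R : realType}.
Implicit Types (phi : R -> R) (g : R * R -> R).

Lemma partial1 g p : derivable (fun x => g (x, p.2)) p.1 1 ->
  derivable g p (1, 0) /\ 'D_(1, 0) g p = derive1 (fun x => g (x, p.2)) p.1.
Proof.
rewrite derive1E /derivable /derive.
rewrite (_ : (fun h => h^-1 *: ((g \o shift p) (h *: (1, 0)) - g p)) =
  fun h => h^-1 *: (((fun x => g (x, p.2)) \o shift p.1) (h *: 1) - g (p.1, p.2))) //.
apply/funext => h; case: p => a b /=; congr (_ *: (g _ - _)).
by congr (_, _); rewrite /= scaler0 add0r.
Qed.

Lemma partial2 g p : derivable (fun y => g (p.1, y)) p.2 1 ->
  derivable g p (0, 1) /\ 'D_(0, 1) g p = derive1 (fun y => g (p.1, y)) p.2.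
Proof.
rewrite derive1E /derivable /derive.
rewrite (_ : (fun h => h^-1 *: ((g \o shift p) (h *: (0, 1)) - g p)) =
  fun h => h^-1 *: (((fun y => g (p.1, y)) \o shift p.2) (h *: 1) - g (p.1, p.2))) //.
apply/funext => h; case: p => a b /=; congr (_ *: (g _ - _)).
by congr (_, _); rewrite /= scaler0 add0r.
Qed.

Lemma smooth_fun_continuous phi : smooth_fun phi -> continuous phi.
Proof.
move=> sphi x; apply/differentiable_continuous/derivable1_diffP.
exact: (sphi 0%N).
Qed.

Lemma smooth_fun_derive1 phi : smooth_fun phi -> smooth_fun (derive1 phi).
Proof.
move=> sphi n x; have := sphi n.+1 x.
by rewrite (_ : derive1n n.+1 phi = derive1n n (derive1 phi))//; exact: iterSr.
Qed.

Lemma smooth_fun_cst (c : R) : smooth_fun (cst c).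
Proof.
move=> n; elim: n c => [|n IH] c x; first exact: derivable_cst.
rewrite (_ : derive1n n.+1 (cst c) = derive1n n (cst 0)); first exact: IH.
rewrite [LHS]iterSr; congr (iter n _ _).
by apply/funext => y; rewrite derive1E derive_cst.
Qed.

Lemma smooth_fun_id : smooth_fun (id : R -> R).
Proof.
case=> [|n] x; first exact: derivable_id.
rewrite derive1Sn (_ : derive1 id = cst 1); first exact: smooth_fun_cst.
by apply/funext => y; rewrite derive1E derive_id.
Qed.

Lemma smooth_fun_affine phi (c d : R) :
  smooth_fun phi -> smooth_fun (fun x => c * phi (x + d)).
Proof.
move=> sphi n; have step (h : R -> R) x : derivable h (x + d) 1 ->
    is_derive x 1 (fun x => c * h (x + d)) (c * derive1 h (x + d)).
  move=> hd; have sh : is_derive x 1 (fun x => h (x + d)) (derive1 h (x + d)).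
    rewrite derive1E; have qE : (fun t => t^-1 *: (((fun x => h (x + d)) \o shift x) (t *: 1)
        - h (x + d))) = (fun t => t^-1 *: ((h \o shift (x + d)) (t *: 1) - h (x + d))).
      by apply/funext => t /=; rewrite addrA.
    by apply: DeriveDef; rewrite /derivable /derive qE.
  exact: is_deriveZ.
have dnE : derive1n n (fun x => c * phi (x + d)) = fun x => c * derive1n n phi (x + d).
  elim: n => [//|n IH]; rewrite derive1nS IH; apply/funext => x.
  by rewrite derive1E derive1nS; have [_ ->] := step _ _ (sphi n (x + d)).
by move=> x; rewrite dnE; have [] := step _ _ (sphi n (x + d)).
Qed.

(** The family $a\,y+\varphi(x)$ is closed under both partial derivatives: they replace
    $(a,\varphi)$ by $(0,\varphi')$ and by $(0,a)$ with $a$ constant. This lets the induction on [k]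
    run. *)
Lemma Ck_shear k (U : set (R * R)) phi (a : R) :
  smooth_fun phi -> Ck k U (fun p => a * p.2 + phi p.1).
Proof.
elim: k phi a => [|k IH] phi a sphi /=.
  move=> p _; move: p; apply: continuous_addr.
    apply: continuous_mulr => p; [exact: cvg_cst|exact: cvg_snd].
  move=> p; apply: (@continuous_comp _ _ _ fst phi); first exact: cvg_fst.
  exact: smooth_fun_continuous.
have d1 (p : R * R) : is_derive p.1 1 (fun x => a * p.2 + phi x) (derive1 phi p.1).
  have := is_deriveD (is_derive_cst (a * p.2) p.1 1) (DeriveDef (sphi 0%N p.1) erefl).
  by rewrite add0r -derive1E.
have d2 (p : R * R) : is_derive p.2 1 (fun y => a * y + phi p.1) a.
  have := is_deriveD (is_deriveZ a (is_derive_id p.2 1)) (is_derive_cst (phi p.1) p.2 1).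
  by rewrite addr0 /GRing.scale /= mulr1.
have D1 p := @partial1 (fun p => a * p.2 + phi p.1) p (@ex_derive _ _ _ _ _ _ _ (d1 p)).
have D2 p := @partial2 (fun p => a * p.2 + phi p.1) p (@ex_derive _ _ _ _ _ _ _ (d2 p)).
split.
- by move=> p _; split; [exact: (D1 p).1|exact: (D2 p).1].
- rewrite [X in Ck k U X](_ : _ = fun p : R * R => 0 * p.2 + derive1 phi p.1).
    by apply: IH; exact: smooth_fun_derive1.
  apply/funext => p; rewrite (D1 p).2 mul0r add0r derive1E.
  by have [_ ->] := d1 p.
- rewrite [X in Ck k U X](_ : _ = fun p : R * R => 0 * p.2 + cst a p.1).
    by apply: IH; exact: smooth_fun_cst.
  apply/funext => p; rewrite (D2 p).2 mul0r add0r derive1E.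
  by have [_ ->] := d2 p.
Qed.

Lemma cdelta_smooth_off_corners (f : R -> R) : smooth_fun f ->
  (forall x, f (- x) = - f x) -> (forall x, f (x + 2 * pi) = f x) ->
  smooth_off_corners (cdelta f).
Proof.
move=> fs fN fP [g t] gtNc; split.
  move=> [_ [m [n ->]] mn]; apply: gtNc; exists (m%:~R * pi, n%:~R * pi).
    by exists m, n.
  (* Each corner is fixed by the injective map [cdelta f], so no other point is sent to a corner. *)
  have [_ [finv [fK _ _]]] := cdelta_homeomorphism fN fP (smooth_fun_continuous fs).
  apply: (can_inj fK); rewrite -mn cdeltaE// (odd_periodic_sin0 fN fP).
    by rewrite mulr0 addr0.
  (* Squaring removes the sign change of the sine under a shift by $\pi$, which makes [periodic_int]
     applicable with period $\pi$. *)
  have sin2Dpi (x : R) : sin (x + pi) ^+ 2 = sin x ^+ 2 by rewrite sinDpi sqrrN.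
  apply/eqP; rewrite -sqrf_eq0 sin2Dpi -[_ * pi]add0r.
  by rewrite (periodic_int sin2Dpi) sin0 expr0n.
(* The twist lifts to a shear of the whole plane, so one lift serves at every point. *)
exists setT, (fun p => (p.1, p.2 + 2 * f (p.1 + pi))); split=> //.
- exact: openT.
- move=> k; split.
    rewrite [X in Ck k _ X](_ : _ = fun p : R * R => 0 * p.2 + id p.1).
      exact: Ck_shear smooth_fun_id.
    by apply/funext => p; rewrite mul0r add0r.
  rewrite [X in Ck k _ X](_ : _ = fun p : R * R => 1 * p.2 + 2 * f (p.1 + pi)).
    by apply: (@Ck_shear k _ (fun x => 2 * f (x + pi))); exact: smooth_fun_affine.
  by apply/funext => p; rewrite mul1r.
- by move=> [x y] _; rewrite cdeltaE.
Qed.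

End CdeltaSmooth.

Theorem theorem9p1 (R : realType) (f : R -> R) :
  smooth_fun f ->
  (forall x, f (- x) = - f x) ->
  (forall x, f (x + 2 * pi) = f x) ->
  homeomorphism (pil_to_R : pillowcase R -> sphere_R R) /\
  (exists iota : pillowcase R -> cobordism_R f,
    [/\ unique (fun j : pillowcase R -> cobordism_R f =>
                  forall x, restrict_end0 (j x) = pil_to_R x) iota,
        homeomorphism iota &
        forall x, restrict_ends (iota x) = (pil_to_R x, pil_to_R (cdelta f x))]) /\
  [/\ forall gamma theta,
        cdelta f (pil (gamma, theta)) = pil (gamma, theta + 2 * f (gamma + pi)),
      homeomorphism (cdelta f) & smooth_off_corners (cdelta f)] /\
  isotopy (fun t : R => cdelta (fun x => t * f x)) id (cdelta f).
Proof.
move=> fs fN fP; have fc := smooth_fun_continuous fs.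
split; first exact: pil_to_R_homeomorphism.
split; last split.
- exists (pil_to_cobordism fN fP); split.
  + split=> [x|j jE]; first exact: restrict_end0_pil_to_cobordism.
    apply/funext => x; apply: (restrict_end0_inj (f := f)).
    by rewrite jE restrict_end0_pil_to_cobordism.
  + exact: pil_to_cobordism_homeomorphism.
  + exact: restrict_ends_pil_to_cobordism.
- split; first by move=> gamma theta; exact: cdeltaE.
  + exact: cdelta_homeomorphism.
  + exact: cdelta_smooth_off_corners.
- exact: cdelta_isotopy.
Qed.
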